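(* The set $$\bigcap_{p\in 2\mathbb{Z}+1}\{\Lambda\subset\mathbb{R}:\ \Lambda \text{ and } p\Lambda \text{ are both spectra for the measure } \mu_4\}$$ has the cardinality of the continuum; i.e., there exist uncountably many discrete sets $\Lambda$ such that the sets $\Lambda$ and $p\Lambda$ are all spectra for $\mu_4$ for all $p\in 2\mathbb{Z}+1$.
   Context: $\mu_4$ denotes the middle-fourth Cantor measure: the unique Borel probability measure on $\mathbb{R}$ satisfying $\mu_4(\cdot)=\frac12\mu_4\circ\tau_1^{-1}(\cdot)+\frac12\mu_4\circ\tau_2^{-1}(\cdot)$, where $\tau_1(x)=4^{-1}x$ and $\tau_2(x)=4^{-1}(x+2)$. A discrete set $\Lambda\subseteq\mathbb{R}$ is a spectrum for a Borel probability measure $\mu$ on $\mathbb{R}$ if the family $\{e^{2\pi i\lambda x}:\lambda\in\Lambda\}$ is an orthonormal basis of $L^2(\mu)$. For $p\in\mathbb{R}$, $p\Lambda=\{p\lambda:\lambda\in\Lambda\}$. $2\mathbb{Z}+1$ is the set of odd integers. *)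

(* Defs.v *)
From HB Require Import structures.
From mathcomp Require Import all_boot all_order all_algebra.
From mathcomp Require Import complex.
From mathcomp Require Import all_classical all_reals all_analysis.

Set Implicit Arguments.
Unset Strict Implicit.
Unset Printing Implicit Defensive.

Import Order.TTheory GRing.Theory Num.Theory.
Import numFieldNormedType.Exports.

Local Open Scope classical_set_scope.
Local Open Scope ring_scope.
Local Open Scope complex_scope.

Local Notation Re := complex.Re.
Local Notation Im := complex.Im.

(* The Lebesgue integral of the library is real-valued, so complex-valued
   functions are handled through their real and imaginary parts. Elements of
   L^2 are represented by functions; almost everywhere equal functions have the
   same inner products and are at L^2-distance 0. *)
Section L2C.
Context (d : measure_display) (T : measurableType d) (R : realType).
Variable mu : {measure set T -> \bar R}.

Definition L2C (f : T -> R[i]) : Prop :=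
  (fun x => Re (f x)) \in Lfun mu 2%:E /\
  (fun x => Im (f x)) \in Lfun mu 2%:E.

Definition L2C_inner (f g : T -> R[i]) : R[i] :=
  Complex (\int[mu]_x Re (f x * (g x)^*)) (\int[mu]_x Im (f x * (g x)^*)).

Definition L2C_norm (f : T -> R[i]) : \bar R :=
  Lnorm mu 2%:E (fun x => (Normc.normc (f x))%:E).

(* A family of unit vectors, pairwise orthogonal, whose linear span is dense. *)
Definition orthonormal_basis (I : eqType) (A : set I) (e : I -> T -> R[i]) :
  Prop :=
  [/\ forall i, A i -> L2C (e i),
      forall i j, A i -> A j -> L2C_inner (e i) (e j) = (i == j)%:R &
      forall f, L2C f -> forall eps : R, 0 < eps ->
        exists (s : seq I) (c : I -> R[i]),
          (forall i, i \in s -> A i) /\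
          (L2C_norm (fun x => (f x - \sum_(i <- s) c i * e i x)%R) < eps%:E)%E].

End L2C.

Section Spectra.
Context (R : realType).
Implicit Types (mu : probability (measurableTypeR R) R) (Lambda : set R).

(* e^(2 pi i lambda x) *)
Definition exp_char (lambda x : R) : R[i] :=
  Complex (cos (2 * pi * lambda * x)) (sin (2 * pi * lambda * x)).

Definition discrete_subset Lambda : Prop := Lambda `<=` isolated Lambda.

Definition is_spectrum mu Lambda : Prop :=
  discrete_subset Lambda /\ orthonormal_basis mu Lambda exp_char.

Definition tau1 (x : R) : R := 4^-1 * x.
Definition tau2 (x : R) : R := 4^-1 * (x + 2).

(* This invariance determines mu uniquely among Borel probability measures. *)
Definition is_mu4 mu : Prop :=
  forall B : set (measurableTypeR R), measurable B ->
    mu B = ((2^-1)%:E * mu (tau1 @^-1` B) + (2^-1)%:E * mu (tau2 @^-1` B))%E.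

Definition odd_integers : set int := range (fun k : int => 2 * k + 1).

Definition dilate (p : R) Lambda : set R := [set p * lambda | lambda in Lambda].

End Spectra.

(* Main.v *)
Require Import Defs.
From HB Require Import structures.
From mathcomp Require Import all_boot all_order all_algebra.
From mathcomp Require Import complex.
From mathcomp Require Import all_classical all_reals all_analysis.
From mathcomp Require Import measurable_realfun.
From mathcomp Require Import zify ring lra.

Set Implicit Arguments.
Unset Strict Implicit.
Unset Printing Implicit Defensive.

Import Order.TTheory GRing.Theory Num.Theory.
Import numFieldNormedType.Exports.

Local Open Scope classical_set_scope.
Local Open Scope card_scope.
Local Open Scope ring_scope.

Local Notation Re := complex.Re.
Local Notation Im := complex.Im.

(** Write [g = |mu^|^2] for the squared modulus of the Fourier transform of [mu4].
Invariance under the two contractions gives [g t = cos(pi t/2)^2 g (t/4)], so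
that [g t = f_n t * g (t/4^n)], where [f_n] is the product of the first [n]
squared cosines. Orthonormality of the characters in [L] and completeness of
their span amount to Parseval's identity [\sum_(l in L) g (t - l) = 1] for all
[t], once trigonometric polynomials are known to be dense in [L^2(mu4)]. They are
dense because bounded limits of polynomials of sines give the indicators of rays,
and then a Dynkin argument gives all Borel sets ([trigonometric_density]).

For finite sets the analogous identity with [f_n] in place of [g] is preserved by
two moves. One passes from level [n] to level [n+1] and replaces [A] by
[A ++ (A + 4^n)] ([spectral_levelS]): a squared cosine and a squared sine add up
to 1. The other translates elements by multiples of [4^n/2], which is a period of
[f_n] ([spectral_level_shift]). As the multipliers [p] are odd, both moves work
for all [p A] at once. Evaluated at [t = - p b], the identity also shows that the
elements of [p A] differ by zeros of [f_n], hence of [g].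

It remains to pass from [f_n] to [g], that is, to bound [g ((t + p l)/4^n)] from
below. All zeros of [g] are integers, and [g >= c(M) > 0] on the points of
[[-M, M]] where [sin(pi x)^2 >= 1/4] ([refinable_ge_far_from_int]). The spectrum
is built as an increasing union of finite sets, in stages that treat one odd [p]
each, every [p] infinitely often. A stage for [p] adds many levels, after which
the old [l] satisfy [p l / 4^n ~ 0]; a new [l] for which [p l / 4^n] is close to
an integer is translated by [4^n/2], which moves [p l / 4^n] by a half-integer.
Then the level-[n] identity reads [1 <= S_i/(1 - e) + (S_(i+1) - S_i)/c] for the
partial Parseval sums [S_i], which increase and are at most 1; so they tend
to 1 ([spectral_tower_sum_cvg1]).

Parseval's identity holds at all [t], so every translate of this set has the same
property for all odd [p]. The set consists of nonnegative numbers and contains 0,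
so that its translates are distinct: there are at least continuum many sets. There
are at most continuum many because a discrete set of reals is determined by the
rational intervals that meet it. *)

(** * Bounds for sines and cosines *)

Section Trigonometry.
Context {R : realType}.
Implicit Types (x y : R) (k : int) (n : nat).

Lemma sqr_cosDpiM x k : cos (x + pi * k%:~R) ^+ 2 = cos x ^+ 2.
Proof.
have nat_case n y : cos (y + pi * n%:R) ^+ 2 = cos y ^+ 2.
  elim: n => [|n IHn]; first by rewrite mulr0 addr0.
  by rewrite -natr1 mulrDr mulr1 addrA cosDpi sqrrN IHn.
case: k => n; first by rewrite -pmulrn nat_case.
by rewrite -(nat_case n.+1) NegzE mulrNz mulrN subrK.
Qed.

Lemma sqr_sinDpiM x k : sin (x + pi * k%:~R) ^+ 2 = sin x ^+ 2.
Proof. by rewrite !sin2cos2 sqr_cosDpiM. Qed.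

Lemma sqr_sinDpihalf_odd x k :
  sin (x + pi * (2 * k + 1)%:~R / 2) ^+ 2 = cos x ^+ 2.
Proof.
have -> : x + pi * (2 * k + 1)%:~R / 2 = x + pi / 2 + pi * k%:~R.
  by rewrite intrD intrM; field.
by rewrite sqr_sinDpiM sinDpihalf.
Qed.

Lemma sqr_cosDpihalf_odd x k :
  cos (x + pi * (2 * k + 1)%:~R / 2) ^+ 2 = sin x ^+ 2.
Proof. by rewrite cos2sin2 sqr_sinDpihalf_odd -sin2cos2. Qed.

Lemma norm_sin_mulrn_le n x : `|sin (x *+ n)| <= n%:R * `|sin x|.
Proof.
elim: n => [|n IHn]; first by rewrite mulr0n sin0 normr0 mul0r.
rewrite mulrS sinD -natr1 mulrDl mul1r addrC.
rewrite (le_trans (ler_normD _ _))// !normrM lerD//.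
  by rewrite (le_trans _ IHn)// ler_piMl ?cos_max.
by rewrite ler_piMr ?cos_max.
Qed.

(** From the duplication formula: a cosine is small only where the sine of the
    doubled angle is. *)
Lemma sqr_sin_le_sqr_cos x : sin (x *+ 2) ^+ 2 / 4 <= cos x ^+ 2.
Proof.
rewrite sin_mulr2n -mulr_natl !exprMn ler_pdivrMr//.
have := sqr_ge0 (cos x).
have : sin x ^+ 2 <= 1 by rewrite sin2cos2 lerBlDr lerDl sqr_ge0.
move=> s1 c0; have := ler_wpM2l c0 s1; lra.
Qed.

Lemma sqr_sinD_ge x y : sin x ^+ 2 - `|sin y| <= sin (x + y) ^+ 2.
Proof.
have E : sin (x + y) ^+ 2 - sin x ^+ 2 = sin (x + y + x) * sin y.
  have -> : sin y = sin (x + y - x) by congr sin; ring.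
  rewrite (sinD (x + y)) (sinB (x + y)).
  have := cos2sin2 (x + y); have := cos2sin2 x.
  set a := sin (x + y); set b := cos (x + y); set c := sin x; set d := cos x.
  move=> Ed Eb; transitivity (a ^+ 2 * d ^+ 2 - b ^+ 2 * c ^+ 2); last by ring.
  by rewrite Ed Eb; ring.
have : `|sin (x + y) ^+ 2 - sin x ^+ 2| <= `|sin y|.
  by rewrite E normrM ler_piMl ?sin_max.
rewrite distrC => /(le_trans (ler_norm _)); lra.
Qed.

End Trigonometry.

(** * Riesz products and spectra of finite level *)

Section RieszProduct.
Context {R : realType}.
Implicit Types (t a : R) (k : int) (n m : nat) (A C : seq R).

(** The squared modulus of the Fourier transform of the uniform measure on the
    [2 ^ n] left end points of the intervals of the [n]-th stage of the Cantor
    construction. *)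
Definition riesz_product n t : R :=
  \prod_(j < n) cos (pi * t / (2 * 4 ^+ j)) ^+ 2.

Lemma riesz_product_ge0 n t : 0 <= riesz_product n t.
Proof. by apply: prodr_ge0 => j _; exact: sqr_ge0. Qed.

Lemma riesz_productS n t :
  riesz_product n.+1 t = riesz_product n t * cos (pi * t / (2 * 4 ^+ n)) ^+ 2.
Proof. by rewrite /riesz_product big_ord_recr. Qed.

Lemma riesz_product0 n : riesz_product n 0 = 1.
Proof. by rewrite /riesz_product big1// => j _; rewrite mulr0 mul0r cos0 expr1n. Qed.

(** [4 ^ n / 2] is a multiple of each denominator [2 * 4 ^ j] with [j < n], and so
    changes each angle by a multiple of [pi]. *)
Lemma riesz_product_periodic n t k :
  riesz_product n (t + 4 ^+ n / 2 * k%:~R) = riesz_product n t.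
Proof.
apply: eq_bigr => j _.
rewrite -[RHS](sqr_cosDpiM _ ((4 ^ (n - j.+1))%:Z * k)).
congr (cos _ ^+ 2); rewrite intrM -pmulrn natrX.
have -> : (4 : R) ^+ n = 4 ^+ (n - j.+1) * (4 * 4 ^+ j).
  by rewrite -exprS -exprD subnK// ltn_ord.
have : (4 : R) ^+ j != 0 by rewrite expf_neq0// pnatr_eq0.
by move: (4 ^+ j) (4 ^+ (n - _)) => u v u0; field.
Qed.

(** Parseval's identity for the characters with frequencies in [p A], [p] odd, in
    [L^2] of the [n]-th approximation of the measure. *)
Definition spectral_level n A := forall k t,
  \sum_(a <- A) riesz_product n (t + (2 * k + 1)%:~R * a) = 1.

Lemma spectral_level0 : spectral_level 0 [:: 0].
Proof. by move=> k t; rewrite big_seq1 /riesz_product big_ord0. Qed.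

(** In the new factor, [4 ^ n p] shifts the angle by an odd multiple of
    [pi / 2]; the old factors do not see it. *)
Lemma spectral_levelS n A : spectral_level n A ->
  spectral_level n.+1 (A ++ [seq a + 4 ^+ n | a <- A]).
Proof.
move=> sA k t; rewrite big_cat big_map/= -big_split/= -[RHS](sA k t).
apply: eq_bigr => a _; set p := (2 * k + 1)%:~R.
rewrite mulrDr addrA; set y := t + p * a.
rewrite !riesz_productS.
have -> : y + p * 4 ^+ n = y + 4 ^+ n / 2 * (2 * (2 * k + 1))%:~R.
  by rewrite /p !intrM; field.
rewrite riesz_product_periodic -mulrDr.
have -> : pi * (y + 4 ^+ n / 2 * (2 * (2 * k + 1))%:~R) / (2 * 4 ^+ n) =
    pi * y / (2 * 4 ^+ n) + pi * (2 * k + 1)%:~R / 2.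
  by rewrite [X in 4 ^+ n / 2 * X]intrM; field; rewrite expf_neq0// pnatr_eq0.
by rewrite sqr_cosDpihalf_odd cos2Dsin2 mulr1.
Qed.

Lemma spectral_level_shift n A C (s : R -> nat) : spectral_level n (A ++ C) ->
  spectral_level n (A ++ [seq c + 4 ^+ n / 2 * (s c)%:R | c <- C]).
Proof.
move=> sAC k t; rewrite big_cat big_map/= -[RHS](sAC k t) big_cat/=.
congr (_ + _); apply: eq_bigr => c _.
rewrite mulrDr addrA -[in RHS](riesz_product_periodic n _ ((2 * k + 1) * (s c)%:Z)).
by congr riesz_product; congr (_ + _); rewrite [in RHS]intrM -pmulrn mulrCA.
Qed.

(** The defining sum at [t = - p b] contains the term 1 at [a = b], so that all
    other terms vanish. *)
Lemma riesz_product_rem n A k a b : spectral_level n A ->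
  b \in A -> a \in rem b A -> riesz_product n ((2 * k + 1)%:~R * (a - b)) = 0.
Proof.
move=> sA bA arA; have := sA k (- ((2 * k + 1)%:~R * b)).
rewrite (perm_big _ (perm_to_rem bA)) big_cons addNr riesz_product0.
move=> /(canRL (addKr _)); rewrite addNr => /eqP.
rewrite big_seq psumr_eq0; last by move=> c _; exact: riesz_product_ge0.
by move=> /allP/(_ _ arA)/implyP/(_ arA)/eqP; rewrite addrC -mulrBr.
Qed.

Lemma spectral_level_uniq n A : spectral_level n A -> uniq A.
Proof.
move=> sA; apply/count_mem_uniq => b.
have [bA|/count_memPn//] := boolP (b \in A).
rewrite (permP (perm_to_rem bA)) /= eqxx; congr (_ + _)%N.
apply/count_memPn/negP => /(riesz_product_rem 0 sA bA).
by rewrite subrr mulr0 riesz_product0 => /eqP; rewrite oner_eq0.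
Qed.

Lemma riesz_product_orthogonal n A k a b : spectral_level n A ->
  a \in A -> b \in A -> a != b -> riesz_product n ((2 * k + 1)%:~R * (a - b)) = 0.
Proof.
move=> sA aA bA ab; apply: (riesz_product_rem _ sA) => //.
by rewrite mem_rem_uniq ?(spectral_level_uniq sA)// inE ab.
Qed.

(** The bound in the conclusion leaves room for a translation by [4 ^ N / 2]. *)
Lemma spectral_level_extend n A m : spectral_level n A ->
  (forall a, a \in A -> 0 <= a <= 4 ^+ n) ->
  exists C, spectral_level (n + m.+1) (A ++ C) /\
    forall a, a \in A ++ C -> 0 <= a <= 4 ^+ (n + m.+1) / 2.
Proof.
move=> sA A01.
have step i B : spectral_level i B -> (forall a, a \in B -> 0 <= a <= 4 ^+ i) ->
    exists C, spectral_level i.+1 (B ++ C) /\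
      forall a, a \in B ++ C -> 0 <= a <= 4 ^+ i.+1 / 2.
  move=> sB B01; exists [seq a + 4 ^+ i | a <- B]; split.
    exact: spectral_levelS.
  have i4 : (0 : R) <= 4 ^+ i by rewrite exprn_ge0.
  move=> a; rewrite mem_cat exprS.
  case/orP => [/B01 /andP[a0 a1]|/mapP[b /B01 /andP[b0 b1] ->]].
    by apply/andP; split=> //; lra.
  by apply/andP; split=> //; lra.
elim: m => [|m [C [sC C01]]]; first by rewrite addn1; exact: step.
have [a /C01/andP[a0 a1]|D [sD D01]] := step _ _ sC.
  by rewrite a0 (le_trans a1)// ler_piMr ?exprn_ge0//; lra.
by exists (C ++ D); rewrite addnS catA.
Qed.

(** New elements [c] for which [p c / 4 ^+ N] is close to an integer are moved by
    [4 ^ N / 2], which puts it close to a half-integer because [p] is odd. *)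
Lemma spectral_level_extend_far n A m k : spectral_level n A ->
  (forall a, a \in A -> 0 <= a <= 4 ^+ n) ->
  exists C, let N := (n + m.+1)%N in
    [/\ spectral_level N (A ++ C),
      forall a, a \in A ++ C -> 0 <= a <= 4 ^+ N &
      forall c, c \in C ->
        2^-1 <= sin (pi * ((2 * k + 1)%:~R * c / 4 ^+ N)) ^+ 2].
Proof.
move=> sA A01; have [C [sC C01]] := spectral_level_extend m sA A01.
set N := (n + m.+1)%N; set p : R := (2 * k + 1)%:~R.
have N4 : (0 : R) < 4 ^+ N by rewrite exprn_gt0.
pose s c : nat := sin (pi * (p * c / 4 ^+ N)) ^+ 2 < 2^-1.
exists [seq c + 4 ^+ N / 2 * (s c)%:R | c <- C] => /=; split.
- exact: spectral_level_shift.
- move=> a; rewrite mem_cat => /orP[aA|/mapP[c cC ->]].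
    have /andP[a0 a1] : 0 <= a <= 4 ^+ N / 2 by apply: C01; rewrite mem_cat aA.
    by rewrite a0/= (le_trans a1)// ler_piMr ?(ltW N4)//; lra.
  have /andP[c0 c1] : 0 <= c <= 4 ^+ N / 2 by apply: C01; rewrite mem_cat cC orbT.
  rewrite /s; case: (_ < _) => /=; rewrite ?mulr1 ?mulr0.
    by apply/andP; split; lra.
  by apply/andP; split; lra.
- move=> _ /mapP[c cC ->]; rewrite /s; case: ltP => [lt|]; last first.
    by rewrite mulr0 addr0.
  have -> : pi * (p * (c + 4 ^+ N / 2 * true%:R) / 4 ^+ N) =
      pi * (p * c / 4 ^+ N) + pi * p / 2.
    by rewrite /=; field; exact: lt0r_neq0.
  by rewrite sqr_sinDpihalf_odd; have := cos2sin2 (pi * (p * c / 4 ^+ N)); lra.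
Qed.

End RieszProduct.

(** * Increasing sequences of spectral levels *)

Section SpectralTower.
Context {R : realType}.
Implicit Types (t x : R) (k : int) (N : nat -> nat) (A : nat -> seq R).

(** Stage [i] treats the multiplier [2 * stage_param i + 1]. *)
Definition stage_param i : int :=
  if @unpickle (int * nat)%type i is Some kn then kn.1 else 0.

Lemma stage_param_infinitely_often k i : exists2 j, (i <= j)%N & stage_param j = k.
Proof.
have inj : injective (fun m : nat => @pickle (int * nat)%type (k, m)).
  by move=> m m' /(pcan_inj pickleK) [].
have [m im] := injective_gtn inj i.
by exists (@pickle (int * nat)%type (k, m)); [exact: ltnW|rewrite /stage_param pickleK].
Qed.

(** Stage [i] passes from level [N i] to level [N i.+1] and adds elements that are
    good for its multiplier. It adds [i.+1] levels so that quotients of old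
    elements by [4 ^ N i.+1] become negligible. *)
Definition spectral_tower N A := forall i,
  [/\ spectral_level (N i) (A i),
      forall a, a \in A i -> 0 <= a <= 4 ^+ N i,
      N i.+1 = (N i + i.+1)%N &
      exists2 C, A i.+1 = A i ++ C &
        forall c, c \in C -> 2^-1 <=
          sin (pi * ((2 * stage_param i + 1)%:~R * c / 4 ^+ N i.+1)) ^+ 2].

Lemma exists_spectral_tower : exists N A, spectral_tower N A /\ A 0 = [:: 0].
Proof.
pose N i := (\sum_(j < i) j.+1)%N.
have NS i : N i.+1 = (N i + i.+1)%N by rewrite /N big_ord_recr.
pose good i (A : seq R) := spectral_level (N i) A /\
  forall a, a \in A -> 0 <= a <= 4 ^+ N i.
have /choice[ext extP] (x : nat * seq R) : exists C, good x.1 x.2 ->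
    good x.1.+1 (x.2 ++ C) /\ forall c, c \in C -> 2^-1 <=
      sin (pi * ((2 * stage_param x.1 + 1)%:~R * c / 4 ^+ N x.1.+1)) ^+ 2.
  have [[sA A01]|] := pselect (good x.1 x.2); last by exists [::].
  have [C []] := spectral_level_extend_far x.1 (stage_param x.1) sA A01.
  by rewrite -NS; exists C.
pose A := fix A i := if i is j.+1 then A j ++ ext (j, A j) else [:: 0].
have goodA i : good i (A i).
  elim: i => [|i /(extP (i, A i)) []//]; rewrite /good /N big_ord0.
  split; first exact: spectral_level0.
  by move=> a; rewrite inE => /eqP ->; rewrite lexx expr0 ler01.
exists N, A; split=> // i; have [sA A01] := goodA i; split=> //.
by exists (ext (i, A i)) => // c; have [_] := extP (i, A i) (goodA i); exact.
Qed.

End SpectralTower.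

(** * Parseval sums along the sequence *)

Section Refinable.
Context {R : realType}.
Variable g : R -> R.
Hypothesis g_refinable : forall t, g t = cos (pi * t / 2) ^+ 2 * g (t / 4).
Hypothesis g_ge0 : forall t, 0 <= g t.
Hypothesis g_le1 : forall t, g t <= 1.
Hypothesis g_near0 : forall e : R, 0 < e ->
  exists2 r : R, 0 < r & forall t, `|t| <= r -> 1 - e <= g t.

(** The function [g] stands for the squared modulus of the Fourier transform of
    the measure: an infinite product of squared cosines, given through its
    functional equation and its behaviour at 0. *)
Lemma refinableE n t : g t = riesz_product n t * g (t / 4 ^+ n).
Proof.
elim: n => [|n ->]; first by rewrite /riesz_product big_ord0 mul1r expr0 divr1.
rewrite riesz_productS -mulrA; congr (_ * _); rewrite g_refinable.
have : (4 : R) ^+ n != 0 by rewrite expf_neq0// pnatr_eq0.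
by rewrite [4 ^+ n.+1]exprS; move: (4 ^+ n) => u u0; congr (cos _ ^+ 2 * g _); field.
Qed.

Lemma refinable_le_riesz n t : g t <= riesz_product n t.
Proof. by rewrite (refinableE n) ler_piMr ?riesz_product_ge0. Qed.

(** Each factor [cos(pi x / (2 4^j))^2] is at least [sin(pi x / 4^j)^2 / 4], and
    [|sin(pi x)| <= 4^j |sin(pi x / 4^j)|]. *)
Lemma riesz_product_ge n (x : R) :
  \prod_(j < n) (sin (pi * x) ^+ 2 / (4 * 16 ^+ j)) <= riesz_product n x.
Proof.
apply: ler_prod => j _; apply/andP; split.
  by rewrite divr_ge0 ?sqr_ge0// mulr_ge0// exprn_ge0.
apply: le_trans (sqr_sin_le_sqr_cos _).
set y := _ *+ 2.
have -> : pi * x = y *+ 4 ^ j.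
  rewrite -mulr_natr natrX /y; field.
  by rewrite expf_neq0// pnatr_eq0.
have -> : (16 : R) ^+ j = (4 ^ j)%:R ^+ 2 by rewrite natrX exprAC; congr (_ ^+ j); ring.
rewrite ler_pdivrMr; last by rewrite mulr_gt0// exprn_gt0// ltr0n expn_gt0.
rewrite mulrA divfK ?pnatr_eq0// mulrC -exprMn.
rewrite -[leLHS]real_normK ?num_real// -[leRHS]real_normK ?num_real// normrM.
by rewrite [`|_%:R|]ger0_norm// lerXn2r ?nnegrE ?mulr_ge0// norm_sin_mulrn_le.
Qed.

Lemma le_expr4_near (x : R) : exists I, forall i, (I <= i)%N -> x <= 4 ^+ i.
Proof.
exists (Num.bound `|x|) => i Ii; rewrite (le_trans (ler_norm x))//.
rewrite (le_trans (ltW (archi_boundP (normr_ge0 x))))//.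
by rewrite -natrX ler_nat (leq_trans Ii)// ltnW// ltn_expl.
Qed.

(** For [|x| <= M], boundedly many squared cosines bring [x] near 0, where [g] is
    at least 1/2; away from integers each of them is bounded below. *)
Lemma refinable_ge_far_from_int (M : R) : exists2 c, 0 < c &
  forall x, `|x| <= M -> 4^-1 <= sin (pi * x) ^+ 2 -> c <= g x.
Proof.
have [|r r0 gr] := g_near0 (_ : 0 < 2^-1); first by rewrite invr_gt0.
have [J /(_ J (leqnn J)) MJ] := le_expr4_near (M / r).
exists (\prod_(j < J) (4^-1 / (4 * 16 ^+ j)) * 2^-1).
  by rewrite mulr_gt0 ?invr_gt0// prodr_gt0// => j _;
    rewrite !divr_gt0 ?mulr_gt0 ?exprn_gt0.
move=> x xM sx; rewrite (refinableE J) ler_pM//.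
- by apply: prodr_ge0 => j _; rewrite !divr_ge0 ?mulr_ge0 ?exprn_ge0.
- apply: le_trans (riesz_product_ge J x); apply: ler_prod => j _.
  rewrite !divr_ge0 ?mulr_ge0 ?exprn_ge0//=.
  by rewrite ler_pM2r// invr_gt0 mulr_gt0 ?exprn_gt0.
- apply: le_trans (gr _ _); first by lra.
  rewrite normrM normfV (ger0_norm (exprn_ge0 _ _))// ler_pdivrMr ?exprn_gt0//.
  by rewrite (le_trans xM)// mulrC -ler_pdivrMr.
Qed.

Variables (N : nat -> nat) (A : nat -> seq R).
Hypothesis towerA : spectral_tower N A.

Lemma spectral_tower_sum_le1 k t i :
  \sum_(a <- A i) g (t + (2 * k + 1)%:~R * a) <= 1.
Proof.
have [sA _ _ _] := towerA i; rewrite -[leRHS](sA k t).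
by apply: ler_sum => a _; exact: refinable_le_riesz.
Qed.

Lemma spectral_tower_increment_small k t (e : R) : 0 < e ->
  exists I, forall i, (I <= i)%N ->
    \sum_(a <- A i.+1) g (t + (2 * k + 1)%:~R * a) -
    \sum_(a <- A i) g (t + (2 * k + 1)%:~R * a) <= e.
Proof.
move=> e0; pose S i := \sum_(a <- A i) g (t + (2 * k + 1)%:~R * a).
have Snd : nondecreasing_seq S.
  apply/nondecreasing_seqP => i; have [_ _ _ [C AS _]] := towerA i.
  by rewrite /S AS big_cat/= lerDl sumr_ge0.
have Scvg : cvgn S.
  apply: nondecreasing_is_cvgn => //; exists 1 => _ [i _ <-].
  exact: spectral_tower_sum_le1.
have /cvgrPdist_le/(_ _ e0)[I _ SI] := Scvg.
exists I => i /SI /=; rewrite -/(S i) -/(S i.+1); apply: le_trans.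
rewrite (le_trans _ (ler_norm _))// lerD2r.
exact: nondecreasing_cvgn_le.
Qed.

(** At a stage where the dilation factor is treated, the argument of [g] in
    [refinableE] is close to 0 for the old elements and far from integers for
    the new ones. Hence the old terms of the spectral level are almost the terms
    of the sum below, and the new ones are comparable to its increment, which is
    small because the partial sums increase and are bounded. *)
Lemma spectral_tower_sum_cvg1 k t (e : R) : 0 < e ->
  exists i, 1 - e <= \sum_(a <- A i) g (t + (2 * k + 1)%:~R * a).
Proof.
move=> e0; set p : R := (2 * k + 1)%:~R.
pose S i := \sum_(a <- A i) g (t + p * a).
have e20 : 0 < e / 2 by rewrite divr_gt0.
have [r r0 gr] := g_near0 e20.
have [c c0 gc] := refinable_ge_far_from_int (`|t| + `|p|).
have [r' r'0 sinr'] : exists2 r', 0 < r' &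
    forall y : R, `|y| <= r' -> `|sin y| <= 4^-1.
  have := @continuous_sin R 0; rewrite /continuous_at sin0.
  have q0 : (0 : R) < 4^-1 by rewrite invr_gt0.
  move=> /cvgrPdist_le/(_ _ q0) /nbhs_ballP[r' /= r'0 sr'].
  exists (r' / 2); first by rewrite divr_gt0.
  move=> y yr'; rewrite -normrN -(sub0r (sin y)); apply: sr'.
  by rewrite /ball/= sub0r normrN; lra.
have [I1 SI1] := spectral_tower_increment_small k t (mulr_gt0 c0 e20).
have [I2 HI2] := le_expr4_near ((`|t| + `|p|) / r).
have [I3 HI3] := le_expr4_near (`|pi * t| / r').
have [i Ii qi] := stage_param_infinitely_often k (maxn I1 (maxn I2 I3)).
move: Ii; rewrite !geq_max => /and3P[I1i I2i I3i].
have {}SI1 := SI1 i I1i.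
exists i; rewrite -/(S i).
have [_ A01 NS [C AS Cfar]] := towerA i.
have [sAS AS01 _ _] := towerA i.+1.
rewrite qi -/p in Cfar.
set n := N i.+1 in NS sAS AS01 Cfar.
have n4 : (0 : R) < 4 ^+ n by rewrite exprn_gt0.
have i4 : (0 : R) < 4 ^+ i.+1 by rewrite exprn_gt0.
have dist1 : (1 : R) <= 4 ^+ N i by rewrite exprn_ege1// ler1n.
pose F := \sum_(a <- A i) riesz_product n (t + p * a).
pose H := \sum_(a <- C) riesz_product n (t + p * a).
have FH1 : F + H = 1 by rewrite -[RHS](sAS k t) AS big_cat.
have F0 : 0 <= F by apply: sumr_ge0 => a _; exact: riesz_product_ge0.
have H0 : 0 <= H by apply: sumr_ge0 => a _; exact: riesz_product_ge0.
(* The arguments of [g] are at most [r] for the old elements. *)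
have old : F * (1 - e / 2) <= S i.
  rewrite /F mulr_suml /S big_seq [leRHS]big_seq; apply: ler_sum => a aA.
  rewrite [leRHS](refinableE n) ler_wpM2l ?riesz_product_ge0//.
  apply: gr; rewrite normrM normfV (gtr0_norm n4) ler_pdivrMr//.
  have /andP[a0 a4] := A01 a aA.
  have := HI2 i.+1 (leqW I2i); rewrite ler_pdivrMr// => HI.
  rewrite (le_trans (ler_normD _ _))// normrM (ger0_norm a0).
  rewrite (@le_trans _ _ ((`|t| + `|p|) * 4 ^+ N i))//.
    by rewrite mulrDl lerD// ?ler_wpM2l// ler_peMr.
  by rewrite NS exprD [4 ^+ N i * _]mulrC mulrA ler_pM2r ?exprn_gt0// mulrC.
(* They are bounded and far from integers for the new ones. *)
have new : H * c <= S i.+1 - S i.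
  rewrite /S AS big_cat/= addrAC subrr add0r.
  rewrite /H mulr_suml big_seq [leRHS]big_seq; apply: ler_sum => a aC.
  rewrite [leRHS](refinableE n) ler_wpM2l ?riesz_product_ge0//.
  have /andP[a0 a4] : 0 <= a <= 4 ^+ n.
    by apply: AS01; rewrite AS mem_cat aC orbT.
  apply: gc.
    rewrite normrM normfV (gtr0_norm n4) ler_pdivrMr// mulrDl.
    rewrite (le_trans (ler_normD _ _))// normrM (ger0_norm a0) lerD//.
      by rewrite ler_peMr// exprn_ege1// ler1n.
    by rewrite ler_wpM2l.
  have -> : pi * ((t + p * a) / 4 ^+ n) =
      pi * (p * a / 4 ^+ n) + pi * (t / 4 ^+ n).
    by rewrite [t + _]addrC (mulrDl _ _ (4 ^+ n)^-1) mulrDr.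
  apply: le_trans (sqr_sinD_ge _ _).
  have sint : `|sin (pi * (t / 4 ^+ n))| <= 4^-1.
    apply: sinr'; rewrite mulrA normrM normfV (gtr0_norm n4) ler_pdivrMr//.
    have := HI3 i.+1 (leqW I3i); rewrite ler_pdivrMr// => /le_trans; apply.
    by rewrite mulrC ler_pM2l// NS exprD ler_peMl// ltW.
  have := Cfar a aC; lra.
have He : H <= e / 2.
  by rewrite -(ler_pM2l c0) mulrC (le_trans new).
have Fe : F * (e / 2) <= e / 2 by rewrite ler_piMl ?(ltW e20)// -FH1 lerDl.
by move: old; rewrite mulrBr mulr1; lra.
Qed.

End Refinable.

(** * The Fourier transform of the Cantor measure *)

Section ProbabilityIntegral.
Context {R : realType} d (T : measurableType d) (mu : probability T R).

Lemma bounded_integrable (f : T -> R) (M : R) : measurable_fun setT f ->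
  (forall x, `|f x| <= M) -> mu.-integrable setT (EFin \o f).
Proof.
move=> mf fM; apply: measurable_bounded_integrable => //.
  by rewrite (le_lt_trans (probability_le1 mu _)) ?ltry.
exists M; split; first exact: num_real.
by move=> y My x _ /=; rewrite (le_trans (fM x))// ltW.
Qed.

Lemma probability_Rintegral_cst (r : R) : \int[mu]_x r = r.
Proof.
rewrite Rintegral_cst// -[RHS]mulr1; congr (_ * _).
by have /(congr1 fine) := probability_setT mu.
Qed.

End ProbabilityIntegral.

Section FourierTransform.
Context {R : realType} (mu : probability (measurableTypeR R) R).
Implicit Types (t x : R).

Lemma measurable_cosM t :
  measurable_fun [set: measurableTypeR R] (fun x : R => cos (t * x)).
Proof.
apply: (@continuous_measurable_fun R) => x.
apply: (@continuous_comp _ _ _ (fun x : R => t * x) (@cos R)).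
  exact: mulrl_continuous.
exact: continuous_cos.
Qed.

Lemma measurable_sinM t :
  measurable_fun [set: measurableTypeR R] (fun x : R => sin (t * x)).
Proof.
apply: (@continuous_measurable_fun R) => x.
apply: (@continuous_comp _ _ _ (fun x : R => t * x) (@sin R)).
  exact: mulrl_continuous.
exact: continuous_sin.
Qed.

Lemma integrable_cosM t :
  mu.-integrable setT (EFin \o (fun x : R => cos (t * x))).
Proof.
apply: (@bounded_integrable _ _ _ mu _ 1); first exact: measurable_cosM.
by move=> x; exact: cos_max.
Qed.

Lemma integrable_sinM t :
  mu.-integrable setT (EFin \o (fun x : R => sin (t * x))).
Proof.
apply: (@bounded_integrable _ _ _ mu _ 1); first exact: measurable_sinM.
by move=> x; exact: sin_max.
Qed.

Definition fourier t : R[i] :=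
  Complex (\int[mu]_x cos (2 * pi * t * x)) (\int[mu]_x sin (2 * pi * t * x)).

Definition fourier_sqr t : R := Re (fourier t) ^+ 2 + Im (fourier t) ^+ 2.

Lemma fourier_sqr_ge0 t : 0 <= fourier_sqr t.
Proof. by rewrite addr_ge0 ?sqr_ge0. Qed.

Lemma fourier0 : fourier 0 = 1.
Proof.
rewrite /fourier; under eq_Rintegral do rewrite mulr0 mul0r cos0.
under [X in Complex _ X]eq_Rintegral do rewrite mulr0 mul0r sin0.
by rewrite !probability_Rintegral_cst.
Qed.

(** If [z] is the value of the transform, then [|z|^2] is the integral of the real
    part of [z^* e^(2 pi i t x)], which is at most [(|z|^2 + 1) / 2]. *)
Lemma fourier_sqr_le1 t : fourier_sqr t <= 1.
Proof.
rewrite /fourier_sqr /=; set u := \int[mu]_x _; set v := \int[mu]_x _.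
have iu := integrable_cosM (2 * pi * t); have iv := integrable_sinM (2 * pi * t).
have iuu := integrableZl measurableT u iu.
have ivv := integrableZl measurableT v iv.
have E : u ^+ 2 + v ^+ 2 =
    \int[mu]_x (u * cos (2 * pi * t * x) + v * sin (2 * pi * t * x)).
  rewrite (RintegralD measurableT iuu ivv).
  by rewrite !RintegralZl// -!expr2.
suff : u ^+ 2 + v ^+ 2 <= (u ^+ 2 + v ^+ 2 + 1) / 2 by lra.
rewrite [leLHS]E -[leRHS](probability_Rintegral_cst mu); apply: le_Rintegral => //.
- exact: (integrableD measurableT iuu ivv).
- by apply: (@bounded_integrable _ _ _ mu _ `|(u ^+ 2 + v ^+ 2 + 1) / 2|).
move=> x _; have := cos2Dsin2 (2 * pi * t * x).
set c := cos _; set s := sin _ => cs1.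
have := sqr_ge0 (u - c); have := sqr_ge0 (v - s); rewrite !sqrrB; nra.
Qed.

(** By continuity of the real part of the transform, which is 1 at 0. *)
Lemma fourier_sqr_near0 (e : R) : 0 < e ->
  exists2 r : R, 0 < r & forall t, `|t| <= r -> 1 - e <= fourier_sqr t.
Proof.
move=> e0.
have ccont (y : R) : continuous (fun t : R => cos (2 * pi * t * y)).
  move=> t; apply: (@continuous_comp _ _ _ (fun t : R => 2 * pi * t * y) (@cos R)).
    apply: (@continuous_comp _ _ _ (fun t : R => 2 * pi * t) (fun z : R => z * y)).
      exact: mulrl_continuous.
    exact: mulrr_continuous.
  exact: continuous_cos.
have := @continuity_under_integral R _ _ mu (fun t x => cos (2 * pi * t * x))
  setT measurableT (-1) 1.
move=> /(_ _ _ (cst 1) _ _ 0).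
have c1 : mu.-integrable setT (EFin \o cst 1%R).
  by apply: (@bounded_integrable _ _ _ mu _ 1) => // x; rewrite normr1.
move=> H.
have {H} : {for (0 : R),
    continuous (fun t : R => (\int[mu]_x cos (2 * pi * t * x))%R)}.
  apply: H => //.
  - by move=> t _; exact: integrable_cosM.
  - by apply: aeW => y _ t _; exact: ccont.
  - by move=> t _; apply: aeW => y _; exact: cos_max.
  - by rewrite inE /= in_itv/= oppr_lt0 ltr01.
have int1 : \int[mu]_x cos (2 * pi * 0 * x) = 1.
  by have /(congr1 (@complex.Re R)) := fourier0.
rewrite /prop_for /continuous_at int1.
have e20 : 0 < e / 2 by rewrite divr_gt0.
move=> /cvgrPdist_le/(_ _ e20) /nbhs_ballP[r /= r0 rP].
exists (r / 2); first by rewrite divr_gt0.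
move=> t tr; have : ball (0 : R) r t by rewrite /ball/= sub0r normrN; lra.
move=> /rP/(le_trans (ler_norm _)) /= ct.
rewrite /fourier_sqr/= -[leLHS]addr0 lerD ?sqr_ge0//.
set u := \int[mu]_x _ in ct *.
have := sqr_ge0 (u - 1); rewrite sqrrB; nra.
Qed.

Lemma exp_char_mulJ t s x : exp_char t x * (exp_char s x)^*%C = exp_char (t - s) x.
Proof.
rewrite /exp_char /= mulrBr mulrBl cosB sinB.
by simpc; congr Complex; ring.
Qed.

Lemma L2C_inner_exp_char t s :
  L2C_inner mu (exp_char t) (exp_char s) = fourier (t - s).
Proof.
rewrite /L2C_inner; congr Complex; apply: eq_Rintegral => x _;
  by rewrite exp_char_mulJ.
Qed.

End FourierTransform.

(** The measure is the half-sum of its two images, so the integral is the half-sum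
    of the integrals along the two maps. *)
Lemma ge0_integral_half_pushforward {R : realType} d (T : measurableType d)
    (mu : {measure set T -> \bar R}) (phi1 phi2 : {mfun T >-> T}) (f : T -> R) :
  (forall B, measurable B ->
    mu B =
      (2^-1)%:E * mu (phi1 @^-1` B) + (2^-1)%:E * mu (phi2 @^-1` B))%E ->
  measurable_fun setT f -> (forall x, 0 <= f x) ->
  (\int[mu]_x (f x)%:E =
    (2^-1)%:E * \int[mu]_x (f (phi1 x))%:E +
    (2^-1)%:E * \int[mu]_x (f (phi2 x))%:E)%E.
Proof.
move=> muE mf f0.
have mEf : measurable_fun setT (EFin \o f) by exact/measurable_EFinP.
have Ef0 (x : T) : (0 <= (EFin \o f) x)%E by rewrite lee_fin.
pose half : {nonneg R} := NngNum (ltac:(by rewrite invr_ge0) : (0 : R) <= 2^-1).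
have mphi1 : measurable_fun setT phi1 by exact: measurable_funP.
have mphi2 : measurable_fun setT phi2 by exact: measurable_funP.
pose p1 : {measure set T -> \bar R} :=
  measure_function_pushforward__canonical__measure_function_Measure mu mphi1.
pose p2 : {measure set T -> \bar R} :=
  measure_function_pushforward__canonical__measure_function_Measure mu mphi2.
rewrite (@eq_measure_integral _ _ _ _
  (measure_add (mscale half p1) (mscale half p2))); last first.
  move=> B mB _; rewrite muE//.
  exact/esym/(measure_addE (mscale half p1) (mscale half p2)).
rewrite (ge0_integral_measure_add _ _ measurableT (fun x _ => Ef0 x) mEf).
congr (_ + _)%E.
  transitivity (half%:num%:E * \int[p1]_x (f x)%:E)%E.
    exact: ge0_integral_mscale.
  by congr (_ * _)%E; apply: (ge0_integral_pushforward mphi1 mu measurableT mEf).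
transitivity (half%:num%:E * \int[p2]_x (f x)%:E)%E.
  exact: ge0_integral_mscale.
by congr (_ * _)%E; apply: (ge0_integral_pushforward mphi2 mu measurableT mEf).
Qed.

Section Mu4.
Context {R : realType} (mu4 : probability (measurableTypeR R) R).
Hypothesis hmu4 : is_mu4 mu4.

Lemma mu4_ge0_integral (f : measurableTypeR R -> R) : measurable_fun setT f ->
  (forall x, 0 <= f x) ->
  (\int[mu4]_x (f x)%:E = (2^-1)%:E * \int[mu4]_x (f (4^-1 * x)%R)%:E +
    (2^-1)%:E * \int[mu4]_x (f (4^-1 * x + 2^-1)%R)%:E)%E.
Proof.
move=> mf f0.
have m1 : measurable_fun [set: measurableTypeR R]
    (@tau1 R : measurableTypeR R -> measurableTypeR R).
  exact: mulrl_measurable.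
have m2 : measurable_fun [set: measurableTypeR R]
    (@tau2 R : measurableTypeR R -> measurableTypeR R).
  by apply: measurable_funM => //; exact: measurable_funD.
pose phi1 : {mfun measurableTypeR R >-> measurableTypeR R} :=
  HB.pack (@tau1 R) (isMeasurableFun.Build _ _ _ _ _ m1).
pose phi2 : {mfun measurableTypeR R >-> measurableTypeR R} :=
  HB.pack (@tau2 R) (isMeasurableFun.Build _ _ _ _ _ m2).
rewrite (@ge0_integral_half_pushforward _ _ _ mu4 phi1 phi2)//.
congr (_ + _ * _)%E; apply: eq_integral => x _; congr (f _)%:E.
by rewrite /= /tau2 mulrDr; congr (_ + _); field.
Qed.

(** The previous lemma for [1 + f], which is nonnegative. *)
Lemma mu4_Rintegral (f : measurableTypeR R -> R) : measurable_fun setT f ->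
  (forall x, `|f x| <= 1) ->
  \int[mu4]_x f x =
    2^-1 * \int[mu4]_x f (4^-1 * x) + 2^-1 * \int[mu4]_x f (4^-1 * x + 2^-1).
Proof.
move=> mf f1.
pose meas (a : R -> R) := measurable_fun [set: measurableTypeR R]
  (a : measurableTypeR R -> measurableTypeR R).
have intf (a : R -> R) : meas a ->
    mu4.-integrable setT (EFin \o (fun x => f (a x))).
  move=> ma; apply: (@bounded_integrable _ _ _ mu4 _ 1); last by move=> x; exact: f1.
  exact: (measurableT_comp mf ma).
have int1 : mu4.-integrable setT (EFin \o (fun=> 1%R)).
  by apply: (@bounded_integrable _ _ _ mu4 _ 1) => // x; rewrite normr1.
have int1f a (ma : meas a) :
    \int[mu4]_x (1 + f (a x)) = 1 + \int[mu4]_x f (a x).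
  rewrite (RintegralD measurableT int1 (intf a ma)).
  by rewrite probability_Rintegral_cst.
have fin1f a (ma : meas a) :
    (\int[mu4]_x (1 + f (a x))%:E)%E = (1 + \int[mu4]_x f (a x))%:E.
  rewrite -int1f// /Rintegral fineK//.
  apply: (integrable_fin_num measurableT).
  exact: (integrableD measurableT int1 (intf a ma)).
have m0 : meas (fun x => x) by exact: measurable_id.
have m1 : meas (fun x => 4^-1 * x) by exact: mulrl_measurable.
have m2 : meas (fun x => 4^-1 * x + 2^-1) by exact: measurable_funD.
have m1f : measurable_fun setT (fun x => 1 + f x) by exact: measurable_funD.
have := mu4_ge0_integral m1f; rewrite (fin1f _ m0) (fin1f _ m1) (fin1f _ m2).
rewrite -!EFinM -EFinD => H.
have {H} : 1 + \int[mu4]_x f x = 2^-1 * (1 + \int[mu4]_x f (4^-1 * x)) +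
    2^-1 * (1 + \int[mu4]_x f (4^-1 * x + 2^-1)).
  apply: EFin_inj; apply: H => x.
  by have := f1 x; rewrite ler_norml => /andP[fx _]; rewrite -lerBlDl sub0r.
lra.
Qed.

Lemma Rintegral_cosD w b : \int[mu4]_x cos (w * x + b) =
  \int[mu4]_x cos (w * x) * cos b - \int[mu4]_x sin (w * x) * sin b.
Proof.
have ic := integrable_cosM mu4 w; have isn := integrable_sinM mu4 w.
under eq_Rintegral do rewrite cosD.
by rewrite (RintegralB measurableT (integrableZr measurableT (cos b) ic)
  (integrableZr measurableT (sin b) isn)) !RintegralZr.
Qed.

Lemma Rintegral_sinD w b : \int[mu4]_x sin (w * x + b) =
  \int[mu4]_x sin (w * x) * cos b + \int[mu4]_x cos (w * x) * sin b.
Proof.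
have ic := integrable_cosM mu4 w; have isn := integrable_sinM mu4 w.
under eq_Rintegral do rewrite sinD.
by rewrite (RintegralD measurableT (integrableZr measurableT (cos b) isn)
  (integrableZr measurableT (sin b) ic)) !RintegralZr.
Qed.

(** The transform at [t] is [(1 + e^(pi i t)) / 2] times the transform at
    [t / 4]. *)
Lemma fourier_sqr_mu4 t :
  fourier_sqr mu4 t = cos (pi * t / 2) ^+ 2 * fourier_sqr mu4 (t / 4).
Proof.
have a1 (x : R) : 2 * pi * t * (4^-1 * x) = 2 * pi * (t / 4) * x by field.
have a2 (x : R) :
    2 * pi * t * (4^-1 * x + 2^-1) = 2 * pi * (t / 4) * x + pi * t by field.
rewrite /fourier_sqr /fourier /=.
rewrite (mu4_Rintegral (measurable_cosM (2 * pi * t))); last first.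
  by move=> x; exact: cos_max.
rewrite (mu4_Rintegral (measurable_sinM (2 * pi * t))); last first.
  by move=> x; exact: sin_max.
set w := 2 * pi * (t / 4) in a1 a2 *.
have -> : \int[mu4]_x cos (2 * pi * t * (4^-1 * x)) =
    \int[mu4]_x cos (w * x).
  by apply: eq_Rintegral => x _; rewrite a1.
have -> : \int[mu4]_x sin (2 * pi * t * (4^-1 * x)) =
    \int[mu4]_x sin (w * x).
  by apply: eq_Rintegral => x _; rewrite a1.
have -> : \int[mu4]_x cos (2 * pi * t * (4^-1 * x + 2^-1)) =
    \int[mu4]_x cos (w * x + pi * t).
  by apply: eq_Rintegral => x _; rewrite a2.
have -> : \int[mu4]_x sin (2 * pi * t * (4^-1 * x + 2^-1)) =
    \int[mu4]_x sin (w * x + pi * t).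
  by apply: eq_Rintegral => x _; rewrite a2.
rewrite Rintegral_cosD Rintegral_sinD.
set C := \int[mu4]_x cos _; set S := \int[mu4]_x sin _.
have ptE : pi * t = (pi * t / 2) *+ 2 by rewrite -mulr_natr; field.
have -> : cos (pi * t) = cos (pi * t / 2) ^+ 2 *+ 2 - 1.
  by rewrite {1}ptE cos_mulr2n.
have -> : sin (pi * t) = (cos (pi * t / 2) * sin (pi * t / 2)) *+ 2.
  by rewrite {1}ptE sin_mulr2n.
transitivity (cos (pi * t / 2) ^+ 2 * (C ^+ 2 + S ^+ 2) *
  (cos (pi * t / 2) ^+ 2 + sin (pi * t / 2) ^+ 2)); first by field.
by rewrite cos2Dsin2 mulr1.
Qed.

End Mu4.

(** * Closed subspaces of the space of square-integrable functions *)

Section L2Closure.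
Context {R : realType} d (T : measurableType d) (mu : probability T R).
Implicit Types (f g h : T -> R[i]) (u v : T -> R) (z w : R[i]).

Definition sqmod z : R := Re z ^+ 2 + Im z ^+ 2.

Lemma sqmod_ge0 z : 0 <= sqmod z. Proof. by rewrite addr_ge0 ?sqr_ge0. Qed.

Lemma sqmodM z w : sqmod (z * w) = sqmod z * sqmod w.
Proof. by case: z w => a b [c e]; rewrite /sqmod/=; ring. Qed.

Lemma sqmod_real (r : R) : sqmod r%:C%C = r ^+ 2.
Proof. by rewrite /sqmod/= expr0n addr0. Qed.

Lemma sqmodD_le z w : sqmod (z + w) <= 2 * sqmod z + 2 * sqmod w.
Proof.
case: z w => a b [c e]; rewrite /sqmod/=.
have := sqr_ge0 (a - c); have := sqr_ge0 (b - e); nra.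
Qed.

Lemma normc_sqmod z : Normc.normc z = Num.sqrt (sqmod z).
Proof. by case: z. Qed.

Definition cmeasurable f : Prop :=
  measurable_fun setT (fun x => Re (f x)) /\
  measurable_fun setT (fun x => Im (f x)).

Lemma cmeasurable_real u : measurable_fun setT u -> cmeasurable (fun x => (u x)%:C%C).
Proof. by []. Qed.

Lemma cmeasurableD f g : cmeasurable f -> cmeasurable g ->
  cmeasurable (fun x => f x + g x).
Proof.
move=> [f1 f2] [g1 g2]; split.
  rewrite [X in measurable_fun _ X](_ : _ = (fun x => Re (f x) + Re (g x))).
    exact: measurable_funD.
  by apply/funext => x; case: (f x) (g x) => [a b] [].
rewrite [X in measurable_fun _ X](_ : _ = (fun x => Im (f x) + Im (g x))).
  exact: measurable_funD.
by apply/funext => x; case: (f x) (g x) => [a b] [].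
Qed.

Lemma cmeasurableZ (c : R[i]) f : cmeasurable f -> cmeasurable (fun x => c * f x).
Proof.
move=> [f1 f2]; split.
  rewrite [X in measurable_fun _ X](_ : _ =
    (fun x => Re c * Re (f x) - Im c * Im (f x))).
    by apply: measurable_funB; exact: measurable_funM.
  by apply/funext => x; case: (c) (f x) => [a b] [].
rewrite [X in measurable_fun _ X](_ : _ =
  (fun x => Re c * Im (f x) + Im c * Re (f x))).
  by apply: measurable_funD; exact: measurable_funM.
by apply/funext => x; case: (c) (f x) => [a b] [].
Qed.

Lemma cmeasurableB f g : cmeasurable f -> cmeasurable g ->
  cmeasurable (fun x => f x - g x).
Proof.
move=> mf mg; rewrite (_ : (fun x => _) = (fun x => f x + -1 * g x)).
  by apply: cmeasurableD => //; exact: cmeasurableZ.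
by apply/funext => x; rewrite mulN1r.
Qed.

Lemma measurable_sqmod f : cmeasurable f ->
  measurable_fun setT (fun x => (sqmod (f x))%:E).
Proof.
move=> [f1 f2]; apply/measurable_EFinP.
by apply: measurable_funD; exact: measurable_funX.
Qed.

(** The square of the distance is easier to handle than the distance: its values
    are integrals, and [L2dist2_triangle] replaces Minkowski's inequality. *)
Definition L2dist2 f g : \bar R := \int[mu]_x (sqmod (f x - g x))%:E.

Lemma L2dist2_triangle f g h (e : R) :
  cmeasurable f -> cmeasurable g -> cmeasurable h ->
  (L2dist2 f g < (e / 4)%:E)%E -> (L2dist2 g h < (e / 4)%:E)%E ->
  (L2dist2 f h < e%:E)%E.
Proof.
move=> mf mg mh fg gh.
have fg0 (x : T) : setT x -> (0 <= 2%:E * (sqmod (f x - g x))%:E)%E.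
  by move=> _; rewrite mule_ge0// lee_fin sqmod_ge0.
have gh0 (x : T) : setT x -> (0 <= 2%:E * (sqmod (g x - h x))%:E)%E.
  by move=> _; rewrite mule_ge0// lee_fin sqmod_ge0.
have mfg := measurable_sqmod (cmeasurableB mf mg).
have mgh := measurable_sqmod (cmeasurableB mg mh).
have m2fg : measurable_fun setT (fun x => 2%:E * (sqmod (f x - g x))%:E)%E.
  exact: measurable_funeM.
have m2gh : measurable_fun setT (fun x => 2%:E * (sqmod (g x - h x))%:E)%E.
  exact: measurable_funeM.
have s0 k l : (forall x : T, setT x -> (0 <= (sqmod (k x - l x : R[i]))%:E)%E).
  by move=> x _; rewrite lee_fin sqmod_ge0.
apply: (@le_lt_trans _ _ (2%:E * L2dist2 f g + 2%:E * L2dist2 g h)%E); last first.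
  have -> : e%:E = (2%:E * (e / 4)%:E + 2%:E * (e / 4)%:E)%E.
    by rewrite -!EFinM -EFinD; congr EFin; field.
  by rewrite lteD// lte_pmul2l.
have twice k l :
    measurable_fun setT (fun x => (sqmod (k x - l x : R[i]))%:E) ->
    (2%:E * L2dist2 k l = \int[mu]_x (2%:E * (sqmod (k x - l x))%:E))%E.
  by move=> mkl; rewrite ge0_integralZl//; exact: s0.
rewrite (twice _ _ mfg) (twice _ _ mgh) -ge0_integralD//.
apply: ge0_le_integral => //.
- exact: s0.
- exact: measurable_sqmod (cmeasurableB mf mh).
- exact: emeasurable_funD.
move=> x _; rewrite -!EFinM -EFinD lee_fin.
by rewrite -[f x - h x](subrKA (g x)) sqmodD_le.
Qed.

Variable V : set (T -> R[i]).
Hypothesis V_cmeasurable : forall f, V f -> cmeasurable f.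
Hypothesis VD : forall f g, V f -> V g -> V (fun x => f x + g x).
Hypothesis VZ : forall c f, V f -> V (fun x => c * f x).

Definition L2closure f : Prop :=
  cmeasurable f /\ forall e : R, 0 < e -> exists2 h, V h & (L2dist2 f h < e%:E)%E.

Lemma L2closure_trans f : cmeasurable f ->
  (forall e : R, 0 < e -> exists2 g, L2closure g & (L2dist2 f g < e%:E)%E) ->
  L2closure f.
Proof.
move=> mf fP; split=> // e e0.
have e4 : 0 < e / 4 by rewrite divr_gt0.
have [g [mg gP] fg] := fP _ e4; have [h Vh gh] := gP _ e4.
by exists h => //; apply: L2dist2_triangle fg gh => //; exact: V_cmeasurable.
Qed.

Lemma L2closureD f g : L2closure f -> L2closure g -> L2closure (fun x => f x + g x).
Proof.
move=> [mf fP] [mg gP]; split; first exact: cmeasurableD.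
move=> e e0; have e4 : 0 < e / 4 by rewrite divr_gt0.
have [h Vh fh] := fP _ e4; have [k Vk gk] := gP _ e4.
exists (fun x => h x + k x); first exact: VD.
have mh := V_cmeasurable Vh; have mk := V_cmeasurable Vk.
apply: (@L2dist2_triangle _ (fun x => h x + g x)) => //; do ?exact: cmeasurableD.
- congr (_ < _)%E : fh; apply: eq_integral => x _; congr (sqmod _)%:E.
  by rewrite opprD addrACA subrr addr0.
- congr (_ < _)%E : gk; apply: eq_integral => x _; congr (sqmod _)%:E.
  by rewrite opprD addrACA subrr add0r.
Qed.

Lemma L2closureZ (c : R[i]) f : L2closure f -> L2closure (fun x => c * f x).
Proof.
move=> [mf fP]; split; first exact: cmeasurableZ.
move=> e e0; have c1 : 0 < sqmod c + 1 by rewrite ltr_wpDl ?sqmod_ge0.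
have [h Vh fh] := fP _ (divr_gt0 e0 c1).
exists (fun x => c * h x); first exact: VZ.
have -> : L2dist2 (fun x => c * f x) (fun x => c * h x) =
    ((sqmod c)%:E * L2dist2 f h)%E.
  have mfh := measurable_sqmod (cmeasurableB mf (V_cmeasurable Vh)).
  rewrite /L2dist2 -ge0_integralZl//;
    [|by move=> x _; rewrite lee_fin sqmod_ge0|by rewrite lee_fin sqmod_ge0].
  by apply: eq_integral => x _; rewrite -mulrBr sqmodM EFinM.
apply: (@le_lt_trans _ _ ((sqmod c)%:E * (e / (sqmod c + 1))%:E)%E).
  by rewrite lee_wpmul2l ?lee_fin ?sqmod_ge0// ltW.
rewrite -EFinM lte_fin mulrCA -[ltRHS]mulr1 ltr_pM2l// ltr_pdivrMr// mul1r.
by rewrite ltrDl.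
Qed.

(** Dominated convergence; the square of the difference is at most [4 v^2]. *)
Lemma L2closure_dominated (u_ : nat -> T -> R) u v :
  (forall n, L2closure (fun x => (u_ n x)%:C%C)) ->
  (forall x, u_ ^~ x @ \oo --> u x) ->
  (forall n x, `|u_ n x| <= v x) ->
  mu.-integrable setT (fun x => (v x ^+ 2)%:E) ->
  L2closure (fun x => (u x)%:C%C).
Proof.
move=> Ku uu uv iv.
have mu_ n : measurable_fun setT (u_ n) by have [[]] := Ku n.
have umeas : measurable_fun setT u.
  exact: (measurable_fun_cvg mu_ (fun x _ => uu x)).
apply: L2closure_trans; first exact: cmeasurable_real.
move=> e e0.
have uv' x : `|u x| <= v x.
  have /cvg_lim <- // : `|u_ n x| @[n --> \oo] --> `|u x| by apply: cvg_norm; exact: uu.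
  apply: limr_le.
    by apply: is_cvg_norm; apply/cvg_ex; exists (u x); exact: uu.
  by apply: nearW => n; exact: uv.
have : (\int[mu]_x ((u x - u_ n x) ^+ 2)%:E @[n --> \oo] -->
    \int[mu]_x (cst 0 x))%E.
  apply: (@dominated_cvg _ _ _ mu setT measurableT _ _
    (fun x => 4%:E * (v x ^+ 2)%:E)%E).
  - move=> n; apply/measurable_EFinP; apply: measurable_funX.
    exact: measurable_funB.
  - move=> x _; apply: cvg_EFin; first exact: nearW.
    rewrite [X in _ --> X](_ : _ = (u x - u x) ^+ 2); last by rewrite subrr expr0n.
    have du : u x - u_ n x @[n --> \oo] --> u x - u x.
      by apply: cvgB; [exact: cvg_cst|exact: uu].
    exact: (cvgM du du).
  - by move=> x _.
  - exact: integrableZl.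
  - move=> n x _; rewrite -EFinM lee_fin ger0_norm ?sqr_ge0//.
    have := uv n x; have := uv' x; rewrite !ler_norml => /andP[a1 a2] /andP[b1 b2].
    have : 0 <= (2 * v x - (u x - u_ n x)) * (2 * v x + (u x - u_ n x)).
      by rewrite mulr_ge0//; lra.
    nra.
rewrite integral0 => /fine_cvgP[nfin /cvgrPdist_lt/(_ e e0) ndist].
have [n _ /(_ n (leqnn n)) /= [nf nl]] := filterI nfin ndist.
exists (fun x => (u_ n x)%:C%C) => //.
have -> : L2dist2 (fun x => (u x)%:C%C) (fun x => (u_ n x)%:C%C) =
    (\int[mu]_x ((u x - u_ n x) ^+ 2)%:E)%E.
  by apply: eq_integral => x _; rewrite -sqmod_real rmorphB.
rewrite -(fineK nf) lte_fin (le_lt_trans (ler_norm _))//.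
by rewrite -normrN -sub0r.
Qed.

End L2Closure.

(** * Polynomials of sines that approximate indicators of rays *)

Section Cutoff.
Context {R : realType}.
Implicit Types (z y r : R) (n : nat).

Lemma bernoulli_ge z n : z <= 1 -> 1 - n%:R * z <= (1 - z) ^+ n.
Proof.
move=> z1; elim: n => [|n IHn]; first by rewrite mul0r subr0.
have := ler_wpM2l (_ : 0 <= 1 - z) IHn; rewrite subr_ge0 z1 -exprS => /(_ isT).
have : 0 <= n%:R * z ^+ 2 by rewrite mulr_ge0 ?sqr_ge0.
rewrite -natr1; nra.
Qed.

Lemma bernoulli_le z n : 0 <= z -> z <= 1 -> (1 - z) ^+ n * (1 + n%:R * z) <= 1.
Proof.
move=> z0 z1; elim: n => [|n IHn]; first by rewrite mul0r addr0 mulr1.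
rewrite (le_trans _ IHn)// exprSr -mulrA ler_wpM2l ?exprn_ge0 ?subr_ge0//.
have : 0 <= n%:R * z ^+ 2 by rewrite mulr_ge0 ?sqr_ge0.
have := sqr_ge0 z; rewrite -natr1; nra.
Qed.

(** For [z = y ^ (2 n)] and [k = n 4 ^ n], the product [k z = n (2 y) ^ (2 n)] tends
    to 0 if [y < 1/2] and to infinity if not; the factor [n] decides the case
    [y = 1/2]. So [(1 - z) ^ k] tends to the indicator of [y < 1/2], by the
    Bernoulli inequalities. *)
Definition cutoff n y : R := (1 - y ^+ (2 * n)) ^+ (n * 4 ^ n).

Lemma cutoff_cvg y : 0 <= y <= 1 -> cutoff ^~ y @ \oo --> ((y < 2^-1)%R%:R : R).
Proof.
move=> /andP[y0 y1].
have z01 n : 0 <= y ^+ (2 * n) <= 1 by rewrite exprn_ge0// exprn_ile1.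
have zE n : (n * 4 ^ n)%:R * y ^+ (2 * n) = n%:R * ((2 * y) ^+ n * (2 * y) ^+ n).
  rewrite natrM -mulrA; congr (_ * _).
  by rewrite natrX exprM -!exprMn; congr (_ ^+ n); ring.
have q0 n : 0 <= cutoff n y by rewrite exprn_ge0// subr_ge0; case/andP: (z01 n).
case: ltP => [yl|yg].
  have r1 : 2 * y < 1 by lra.
  have r0 : 0 <= 2 * y by lra.
  (* [bernoulli_le] gives [n r ^ n <= 1 / (1 - r)] for [r = 2 y]. *)
  apply: (@squeeze_cvgr _ _ _ _
    (fun n => 1 - (2 * y) ^+ n / (1 - 2 * y)) (cst 1)).
  - apply: nearW => n; have /andP[z0 z1] := z01 n.
    rewrite exprn_ile1 ?subr_ge0 ?gerBl// andbT.
    apply: le_trans (bernoulli_ge _ z1); rewrite lerD2l lerN2 zE mulrA mulrC.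
    rewrite ler_wpM2l ?exprn_ge0//.
    have c0 : 0 <= 1 - 2 * y by lra.
    have c1 : 1 - 2 * y <= 1 by lra.
    have := bernoulli_le n c0 c1; rewrite opprB addrC subrK mulrDr mulr1 => H.
    rewrite -[leRHS]mul1r ler_pdivlMr ?subr_gt0//.
    have : 0 <= (2 * y) ^+ n by rewrite exprn_ge0.
    nra.
  - rewrite [X in _ --> X](_ : _ = 1 - 0 / (1 - 2 * y)); last by rewrite mul0r subr0.
    apply: cvgB; first exact: cvg_cst.
    apply: cvgM; last exact: cvg_cst.
    by apply: cvg_expr; rewrite ger0_norm.
  - exact: cvg_cst.
apply: (@squeeze_cvgr _ _ _ _ (cst 0) (@harmonic R)).
- apply: nearW => n; rewrite q0/= /harmonic -[leRHS]mul1r ler_pdivlMr//.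
  have /andP[z0 z1] := z01 n; apply: le_trans (bernoulli_le (n * 4 ^ n) z0 z1).
  rewrite ler_wpM2l// -natr1 addrC lerD2l zE ler_peMr//.
  by rewrite -exprMn exprn_ege1//; nra.
- exact: cvg_cst.
- exact: cvg_harmonic.
Qed.

(** A sine of large period has the sign of its argument on a large interval. *)
Lemma cutoff_sin_cvg (x a : R) :
  (((1 + sin (2 * pi * k.+1%:R^-1 * x - 2 * pi * k.+1%:R^-1 * a)) / 2
    < 2^-1)%R%:R : R) @[k --> \oo] --> ((x < a)%R%:R : R).
Proof.
apply: cvg_near_cst; exists (Num.bound (2 * `|x - a|)) => // k /= bk.
have k0 : (0 : R) < k.+1%:R by [].
have xk : 2 * `|x - a| < k.+1%:R.
  rewrite (lt_le_trans (archi_boundP _)) ?mulr_ge0// ler_nat.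
  exact: leqW.
have E : 2 * pi * k.+1%:R^-1 * x - 2 * pi * k.+1%:R^-1 * a =
    pi * (2 * (x - a) / k.+1%:R).
  by field; rewrite addrC natr1 lt0r_neq0.
rewrite E; set w := 2 * (x - a) / k.+1%:R.
have w1 : `|w| < 1.
  rewrite /w normrM normfV (gtr0_norm k0) ltr_pdivrMr// mul1r.
  by rewrite normrM (ger0_norm (ler0n _ _)).
have pi0 := @pi_gt0 R.
congr (nat_of_bool _)%:R; case: (ltP x a) => xa.
  have w0 : w < 0 by rewrite /w pmulr_llt0 ?invr_gt0//; lra.
  have : 0 < sin (pi * (- w)).
    apply: sin_gt0_pi; rewrite ltr0_norm// in w1; apply/andP; split; nra.
  by rewrite mulrN sinN => ?; apply: (introT idP); lra.
have w0 : 0 <= w by rewrite /w pmulr_lge0 ?invr_gt0//; lra.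
have : 0 <= sin (pi * w).
  apply: sin_ge0_pi; rewrite ger0_norm// in w1; apply/andP; split; nra.
by move=> ?; apply/negbTE; rewrite -leNgt; lra.
Qed.

End Cutoff.

(** * Density of trigonometric polynomials *)

Section TrigonometricDensity.
Context {R : realType} (mu : probability (measurableTypeR R) R).
Implicit Types (f g : R -> R[i]) (u v : R -> R).

Inductive trig_poly : (R -> R[i]) -> Prop :=
| trig_poly_exp (c : R[i]) (t : R) : trig_poly (fun x => c * exp_char t x)
| trig_polyD f g : trig_poly f -> trig_poly g -> trig_poly (fun x => f x + g x).

Lemma exp_charD (s t x : R) : exp_char s x * exp_char t x = exp_char (s + t) x.
Proof.
rewrite /exp_char (mulrDr (2 * pi)) (mulrDl _ _ x) cosD sinD; simpc.
by congr Complex; ring.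
Qed.

Lemma trig_polyM f g : trig_poly f -> trig_poly g -> trig_poly (fun x => f x * g x).
Proof.
move=> Tf Tg; elim: Tf => [c t|f1 f2 _ T1 _ T2]; last first.
  by under eq_fun do rewrite mulrDl; exact: trig_polyD.
elim: Tg => [c' t'|g1 g2 _ T1 _ T2]; last first.
  by under eq_fun do rewrite mulrDr; exact: trig_polyD.
by under eq_fun do rewrite mulrACA exp_charD; exact: trig_poly_exp.
Qed.

Definition real_trig_poly u := trig_poly (fun x => (u x)%:C%C).

Lemma real_trig_poly_cst (r : R) : real_trig_poly (fun=> r).
Proof.
rewrite /real_trig_poly (_ : (fun=> _) = (fun x => r%:C%C * exp_char 0 x)).
  exact: trig_poly_exp.
apply/funext => x.
by rewrite /exp_char mulr0 mul0r cos0 sin0 mulr1.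
Qed.

Lemma real_trig_polyD u v : real_trig_poly u -> real_trig_poly v ->
  real_trig_poly (fun x => u x + v x).
Proof.
move=> Tu Tv; rewrite /real_trig_poly; under eq_fun do rewrite rmorphD.
exact: trig_polyD.
Qed.

Lemma real_trig_polyM u v : real_trig_poly u -> real_trig_poly v ->
  real_trig_poly (fun x => u x * v x).
Proof.
move=> Tu Tv; rewrite /real_trig_poly; under eq_fun do rewrite rmorphM.
exact: trig_polyM.
Qed.

Lemma real_trig_polyX u n : real_trig_poly u -> real_trig_poly (fun x => u x ^+ n).
Proof.
move=> Tu; elim: n => [|n IHn]; first exact: real_trig_poly_cst.
by under eq_fun do rewrite exprS; exact: real_trig_polyM.
Qed.

Lemma real_trig_polyB u v : real_trig_poly u -> real_trig_poly v ->
  real_trig_poly (fun x => u x - v x).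
Proof.
move=> Tu Tv; under eq_fun do rewrite -mulN1r.
apply: real_trig_polyD => //; apply: real_trig_polyM => //.
exact: real_trig_poly_cst.
Qed.

Lemma real_trig_poly_cos (t : R) : real_trig_poly (fun x => cos (2 * pi * t * x)).
Proof.
rewrite /real_trig_poly (_ : (fun _ => _) =
    (fun x => (2^-1)%:C%C * exp_char t x +
              (2^-1)%:C%C * exp_char (- t) x)).
  by apply: trig_polyD; exact: trig_poly_exp.
apply/funext => x; rewrite /exp_char mulrN mulNr cosN sinN; simpc.
by congr Complex; field.
Qed.

Lemma real_trig_poly_sin (t : R) : real_trig_poly (fun x => sin (2 * pi * t * x)).
Proof.
rewrite /real_trig_poly (_ : (fun _ => _) =
    (fun x => Complex 0 (- 2^-1) * exp_char t x +
              Complex 0 (2^-1) * exp_char (- t) x)).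
  by apply: trig_polyD; exact: trig_poly_exp.
apply/funext => x; rewrite /exp_char mulrN mulNr cosN sinN; simpc.
by congr Complex; field.
Qed.

Lemma real_trig_poly_cutoff (t a : R) n : real_trig_poly
  (fun x => cutoff n ((1 + sin (2 * pi * t * x - 2 * pi * t * a)) / 2)).
Proof.
apply: real_trig_polyX; apply: real_trig_polyB; first exact: real_trig_poly_cst.
apply: real_trig_polyX; apply: real_trig_polyM; last exact: real_trig_poly_cst.
apply: real_trig_polyD; first exact: real_trig_poly_cst.
under eq_fun do rewrite sinB.
by apply: real_trig_polyB; apply: real_trig_polyM;
  do ?[exact: real_trig_poly_cst|exact: real_trig_poly_sin|exact: real_trig_poly_cos].
Qed.

(** [K] stands for the closure in [L^2] of the span of some of the characters,
    when all characters are known to be in it. *)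
Variable K : set (R -> R[i]).
Hypothesis K_exp : forall t, K (exp_char t).
Hypothesis KD : forall f g, K f -> K g -> K (fun x => f x + g x).
Hypothesis KZ : forall (c : R[i]) f, K f -> K (fun x => c * f x).
Hypothesis K_dominated : forall (u_ : nat -> R -> R) u v,
  (forall n, K (fun x => (u_ n x)%:C%C)) ->
  (forall x, u_ ^~ x @ \oo --> u x) ->
  (forall n x, `|u_ n x| <= v x) ->
  mu.-integrable setT (fun x => (v x ^+ 2)%:E) ->
  K (fun x => (u x)%:C%C).

Lemma trig_poly_sub f : trig_poly f -> K f.
Proof.
elim=> [c t|f1 f2 _ K1 _ K2]; last exact: KD.
by apply: KZ; exact: K_exp.
Qed.

Lemma closed_bounded_limit (u_ : nat -> R -> R) u :
  (forall n, K (fun x => (u_ n x)%:C%C)) ->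
  (forall x, u_ ^~ x @ \oo --> u x) ->
  (forall n x, 0 <= u_ n x <= 1) -> K (fun x => (u x)%:C%C).
Proof.
move=> Ku uu u01; apply: (K_dominated (v := cst 1) Ku uu).
  by move=> n x; have /andP[u0 u1] := u01 n x; rewrite ger0_norm.
by apply: (@bounded_integrable _ _ _ mu (fun=> 1 ^+ 2) 1) => // x; rewrite expr1n normr1.
Qed.

(** Two successive limits: cutoffs of a sine, then sines of growing period. *)
Lemma closed_ray_indicator (a : R) : K (fun x => ((x < a)%R%:R : R)%:C%C).
Proof.
apply: (@closed_bounded_limit (fun k x =>
    ((1 + sin (2 * pi * k.+1%:R^-1 * x - 2 * pi * k.+1%:R^-1 * a)) / 2
      < 2^-1)%R%:R)).
- move=> k; set w := k.+1%:R^-1.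
  have s01 x : 0 <= (1 + sin (2 * pi * w * x - 2 * pi * w * a)) / 2 <= 1.
    have := sin_le1 (2 * pi * w * x - 2 * pi * w * a).
    have := sin_geN1 (2 * pi * w * x - 2 * pi * w * a).
    by move=> ? ?; apply/andP; split; lra.
  apply: (@closed_bounded_limit
    (fun n x =>
      cutoff n ((1 + sin (2 * pi * w * x - 2 * pi * w * a)) / 2))).
  + by move=> n; apply: trig_poly_sub; exact: real_trig_poly_cutoff.
  + by move=> x; exact: cutoff_cvg.
  + move=> n x; have /andP[s0 s1] := s01 x.
    have z0 := exprn_ge0 (2 * n) s0.
    have z1 := exprn_ile1 (2 * n) s0 s1.
    by rewrite exprn_ge0 ?subr_ge0// exprn_ile1 ?subr_ge0// gerBl.
- by move=> x; exact: cutoff_sin_cvg.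
- by move=> k x; rewrite ler0n lern1 leq_b1.
Qed.

Lemma closed_realD u v : K (fun x => (u x)%:C%C) -> K (fun x => (v x)%:C%C) ->
  K (fun x => (u x + v x)%:C%C).
Proof. by move=> Ku Kv; under eq_fun do rewrite rmorphD; exact: KD. Qed.

Lemma closed_realZ (r : R) u : K (fun x => (u x)%:C%C) -> K (fun x => (r * u x)%:C%C).
Proof. by move=> Ku; under eq_fun do rewrite rmorphM; exact: KZ. Qed.

(** The rays are a generating pi-system, and the sets with indicator in [K] are a
    Dynkin system. *)
Lemma closed_indicator (B : set (measurableTypeR R)) : measurable B ->
  K (fun x => (\1_B x : R)%:C%C).
Proof.
have K1 : K (fun x => (1 : R)%:C%C).
  by apply: trig_poly_sub; exact: real_trig_poly_cst.
have K0 : K (fun x => (0 : R)%:C%C).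
  by apply: trig_poly_sub; exact: real_trig_poly_cst.
move=> mB; have := mB; rewrite -[measurable B]/((@ocitv R).-sigma.-measurable B).
rewrite RGenInftyO.measurableE.
apply: (@dynkin_induction _ (measurableTypeR R) (@RGenInftyO.G R)
  (fun B => K (fun x => (\1_B x : R)%:C%C))).
- exact: RGenInftyO.measurableE.
- move=> _ _ [a ->] [b ->]; exists (Num.min a b).
  by apply/seteqP; split => x /=; rewrite !in_itv/= lt_min => /andP.
- by under eq_fun do rewrite indicT.
- move=> _ [a ->]; have := closed_ray_indicator a; congr K; apply/funext => x.
  by rewrite indicE; congr ((nat_of_bool _)%:R)%:C%C; apply/idP/idP; rewrite inE/= in_itv.
- move=> S mS KS; have := closed_realD K1 (closed_realZ (-1) KS); congr K.
  apply/funext => x; rewrite !indicE in_setC; congr _%:C%C.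
  by case: (x \in S); rewrite /= ?mulr1 ?mulr0 ?addr0 ?subrr.
- move=> F mF tF KF; apply: (@closed_bounded_limit
    (fun n x => \1_(\big[setU/set0]_(k < n) F k) x)).
  + elim=> [|n IHn]; first by under eq_fun do rewrite big_ord0 indic0.
    have := closed_realD IHn (KF n); congr K; apply/funext => x; congr _%:C%C.
    rewrite big_ord_recr/= !indicE in_setU.
    have [xn|xn] := boolP (x \in F n); last by rewrite orbF addr0.
    rewrite orbT (_ : (x \in _) = false) ?add0r//; apply/negbTE.
    apply/negP; rewrite inE -bigcup_mkord => -[k /= kn Fkx].
    have /(_ (ex_intro _ x (conj Fkx (set_mem xn)))) kE := tF k n I I.
    by rewrite kE ltnn in kn.
  + move=> x; have [xF|xF] := pselect ((\bigcup_k F k) x).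
      apply: cvg_near_cst; have [k _ Fkx] := xF; exists k.+1 => // n /= kn.
      rewrite !indicE !mem_set//.
      by rewrite -bigcup_mkord; exists k.
    apply: cvg_near_cst; apply: nearW => n; rewrite !indicE !memNset//.
    by rewrite -bigcup_mkord => -[k _ Fkx]; apply: xF; exists k.
  + by move=> n x; rewrite indicE ler0n lern1 leq_b1.
Qed.

Import HBNNSimple.

Lemma closed_simple (h : {nnsfun measurableTypeR R >-> R}) :
  K (fun x => (h x)%:C%C).
Proof.
under eq_fun do rewrite fimfunE fsbig_finite//.
elim: (finmap.enum_fset _) => [|y s IHs].
  under eq_fun do rewrite big_nil.
  by apply: trig_poly_sub; exact: real_trig_poly_cst.
under eq_fun do rewrite big_cons.
by apply: closed_realD => //; apply: closed_realZ; exact: closed_indicator.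
Qed.

Lemma closed_ge0_square_integrable (u : measurableTypeR R -> R) :
  measurable_fun setT u -> (forall x, 0 <= u x) ->
  mu.-integrable setT (fun x => (u x ^+ 2)%:E) -> K (fun x => (u x)%:C%C).
Proof.
move=> umeas u0 iu.
have mEu : measurable_fun setT (EFin \o u) by exact/measurable_EFinP.
pose h := nnsfun_approx measurableT mEu.
have hu x : h ^~ x @ \oo --> u x.
  have := @cvg_nnsfun_approx _ _ _ _ measurableT _ mEu (fun x _ => u0 x) x I.
  by move=> /fine_cvgP[].
apply: (K_dominated (u_ := fun n x => h n x) _ hu _ iu) => [n|n x].
  exact: closed_simple.
rewrite ger0_norm//.
have hnd : nondecreasing_seq (h ^~ x).
  by move=> m m' mm'; have /lefP/(_ x) := nd_nnsfun_approx measurableT mEu mm'.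
rewrite -(cvg_lim _ (hu x))//; apply: nondecreasing_cvgn_le => //.
by apply/cvg_ex; exists (u x).
Qed.

Lemma closed_real_square_integrable (u : measurableTypeR R -> R) :
  measurable_fun setT u ->
  mu.-integrable setT (fun x => (u x ^+ 2)%:E) -> K (fun x => (u x)%:C%C).
Proof.
move=> umeas iu.
have part (s : R) : `|s| = 1 -> K (fun x => (Num.max (s * u x) 0)%:C%C).
  move=> s1; have ms : measurable_fun setT (fun x => Num.max (s * u x) 0).
    by apply: measurable_maxr => //; exact: measurable_funM.
  apply: closed_ge0_square_integrable => //.
    by move=> x; rewrite le_max lexx orbT.
  apply: le_integrable iu => //.
    by apply/measurable_EFinP; exact: measurable_funX.
  move=> x _; rewrite lee_fin !ger0_norm ?sqr_ge0//.
  rewrite -[leRHS]real_normK ?num_real// lerXn2r ?nnegrE ?le_max ?lexx ?orbT//.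
  by rewrite ge_max normr_ge0 andbT (le_trans (ler_norm _))// normrM s1 mul1r.
have := closed_realD (part 1 (normr1 _))
  (closed_realZ (-1) (part (-1) (normrN1 _))).
congr K; apply/funext => x; congr _%:C%C.
rewrite mul1r !mulN1r /Num.max.
by case: (ltP (u x) 0) => ?; case: (ltP (- u x) 0) => ?; lra.
Qed.

(** This says that trigonometric polynomials are dense in [L^2] of any probability
    measure on the line. *)
Lemma trigonometric_density f : cmeasurable (f : measurableTypeR R -> R[i]) ->
  mu.-integrable setT (fun x => (Re (f x) ^+ 2)%:E) ->
  mu.-integrable setT (fun x => (Im (f x) ^+ 2)%:E) -> K f.
Proof.
move=> [mRe mIm] iRe iIm.
have := KD (closed_real_square_integrable mRe iRe)
  (KZ (Complex 0 1) (closed_real_square_integrable mIm iIm)).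
congr K; apply/funext => x; case: (f x) => a b /=.
by simpc.
Qed.

End TrigonometricDensity.

(** * Projections on finitely many characters *)

Section SpectrumCriterion.
Context {R : realType} (mu : probability (measurableTypeR R) R).
Implicit Types (s t a : R) (z w : R[i]).

Lemma complex_ReD z w : Re (z + w) = Re z + Re w.
Proof. by case: z w => a b []. Qed.

Lemma Re_mulJ z : Re (z * z^*%C) = sqmod z.
Proof. by case: z => a b; rewrite /sqmod/=; ring. Qed.

Lemma mulJ_sqmod z : z * z^*%C = (sqmod z)%:C%C.
Proof. by case: z => a b; rewrite /sqmod/=; simpc; congr Complex; ring. Qed.

Lemma fourierN t : fourier mu (- t) = (fourier mu t)^*%C.
Proof.
rewrite /fourier /=; congr Complex.
  by apply: eq_Rintegral => x _; rewrite mulrN mulNr cosN.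
rewrite -mulN1r -(RintegralZl _ measurableT (integrable_sinM mu _)).
by apply: eq_Rintegral => x _; rewrite mulrN mulNr sinN mulN1r.
Qed.

Lemma sqmod_fourier t : sqmod (fourier mu t) = fourier_sqr mu t.
Proof. by []. Qed.

Lemma Rintegral_Re_sum (I : Type) (r : seq I) (c : I -> R[i]) (t : I -> R) :
  mu.-integrable setT
    (EFin \o (fun x => Re (\sum_(i <- r) c i * exp_char (t i) x))) /\
  \int[mu]_x Re (\sum_(i <- r) c i * exp_char (t i) x) =
    Re (\sum_(i <- r) c i * fourier mu (t i)).
Proof.
elim: r => [|i r [intr IHr]].
  have E : (fun x => Re (\sum_(i <- [::]) c i * exp_char (t i) x)) = cst 0.
    by apply/funext => x; rewrite big_nil.
  rewrite E; split.
    by apply: (@bounded_integrable _ _ _ mu _ 0) => // x; rewrite normr0.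
  by rewrite big_nil probability_Rintegral_cst.
have ic := integrable_cosM mu (2 * pi * t i).
have isn := integrable_sinM mu (2 * pi * t i).
have i1 := integrableB measurableT (integrableZl measurableT (Re (c i)) ic)
  (integrableZl measurableT (Im (c i)) isn).
have E : (fun x => Re (\sum_(j <- i :: r) c j * exp_char (t j) x)) = (fun x =>
    (Re (c i) * cos (2 * pi * t i * x) -
     Im (c i) * sin (2 * pi * t i * x)) +
    Re (\sum_(j <- r) c j * exp_char (t j) x)).
  by apply/funext => x; rewrite big_cons complex_ReD; case: (c i).
rewrite E; split; first exact: (integrableD measurableT i1 intr).
rewrite (RintegralD measurableT i1 intr) IHr big_cons complex_ReD; congr (_ + _).
rewrite (RintegralB measurableT (integrableZl measurableT (Re (c i)) ic)
  (integrableZl measurableT (Im (c i)) isn)).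
by rewrite !RintegralZl//; case: (c i).
Qed.

(** The square of the modulus of a trigonometric polynomial is the real part of
    a trigonometric polynomial indexed by pairs. *)
Lemma integral_sqmod_sum (I : Type) (r : seq I) (c : I -> R[i]) (t : I -> R) :
  (\int[mu]_x (sqmod (\sum_(i <- r) c i * exp_char (t i) x))%:E)%E =
  (Re (\sum_(i <- r) \sum_(j <- r) c i * (c j)^*%C * fourier mu (t i - t j)))%:E.
Proof.
have [int E] := Rintegral_Re_sum [seq (i, j) | i <- r, j <- r]
  (fun ij => c ij.1 * (c ij.2)^*%C) (fun ij => t ij.1 - t ij.2).
rewrite big_allpairs/= in E; rewrite -E /Rintegral fineK; last first.
  exact: (integrable_fin_num measurableT int).
apply: eq_integral => x _; congr EFin; rewrite big_allpairs/= -Re_mulJ.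
congr (Re _); rewrite rmorph_sum mulr_suml; apply: eq_bigr => i _.
rewrite mulr_sumr; apply: eq_bigr => j _.
by rewrite rmorphM mulrACA exp_char_mulJ.
Qed.

(** Pythagoras: the sum is the orthogonal projection of the character. *)
Lemma L2dist2_exp_char_projection t (r : seq R) : uniq r ->
  (forall a b, a \in r -> b \in r -> a != b -> fourier mu (a - b) = 0) ->
  L2dist2 mu (exp_char t)
    (fun x => \sum_(a <- r) fourier mu (t - a) * exp_char a x) =
  (1 - \sum_(a <- r) fourier_sqr mu (t - a))%:E.
Proof.
move=> ur orth; pose c a := fourier mu (t - a).
pose c' i : R[i] := if i is Some a then - c a else 1.
pose t' i : R := if i is Some a then a else t.
(* [None] indexes the projected character. *)
have := integral_sqmod_sum (None :: [seq Some a | a <- r]) c' t'.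
rewrite [X in X = _ -> _](_ : _ = L2dist2 mu (exp_char t)
    (fun x => \sum_(a <- r) c a * exp_char a x)); last first.
  apply: eq_integral => x _; rewrite big_cons big_map /= mul1r; congr (sqmod (_ + _))%:E.
  by rewrite -sumrN; apply: eq_bigr => a _; rewrite mulNr.
move=> ->; congr EFin.
transitivity (Re (1 * 1^*%C * fourier mu (t - t) +
  \sum_(a <- r) 1 * (- c a)^*%C * fourier mu (t - a) + \sum_(a <- r)
    (- c a * 1^*%C * fourier mu (a - t) +
     \sum_(b <- r) - c a * (- c b)^*%C * fourier mu (a - b)))).
  rewrite !big_cons !big_map; congr (Re (_ + _)).
  by apply: eq_bigr => a _; rewrite big_cons big_map.
rewrite subrr fourier0 conjc1 !mulr1.
have -> : \sum_(a <- r) 1 * (- c a)^*%C * fourier mu (t - a) =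
    - (\sum_(a <- r) fourier_sqr mu (t - a))%:C%C.
  rewrite rmorph_sum -sumrN; apply: eq_bigr => a _.
  by rewrite mul1r rmorphN mulNr mulrC -/(c a) mulJ_sqmod.
have -> : \sum_(a <- r) (- c a * 1 * fourier mu (a - t) +
    \sum_(b <- r) - c a * (- c b)^*%C * fourier mu (a - b)) = 0.
  rewrite big_seq big1// => a ar; rewrite mulr1 -(opprB t a) fourierN -/(c a).
  rewrite (bigD1_seq a ar ur) subrr fourier0 mulr1 big_seq_cond.
  rewrite big1 ?addr0 => [|b /andP[br ba]].
    rewrite rmorphN mulrNN mulNr.
    rewrite -[LHS]/(- (c a * (c a)^*%C) + (c a * (c a)^*%C + 0)).
    by rewrite addr0 addNr.
  by rewrite orth ?mulr0// eq_sym.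
by rewrite addr0 complex_ReD -rmorphN.
Qed.

End SpectrumCriterion.

(** * A criterion for spectra *)

Lemma bounded_Lfun2 {R : realType} d (T : measurableType d) (mu : probability T R)
    (f : T -> R) (M : R) : measurable_fun setT f -> (forall x, `|f x| <= M) ->
  f \in Lfun mu 2%:E.
Proof.
move=> mf fM; rewrite inE; apply/andP; split; rewrite inE//=.
rewrite /finite_norm unlock; apply: poweR_lty.
have /integrableP[_] : mu.-integrable setT (EFin \o (fun x => f x ^+ 2)).
  apply: (@bounded_integrable _ _ _ _ _ (M ^+ 2)); first exact: measurable_funX.
  by move=> x; rewrite normrX lerXn2r ?nnegrE ?(le_trans _ (fM x)).
apply: le_lt_trans; rewrite le_eqVlt; apply/orP; left; apply/eqP.
apply: eq_integral => x _ /=.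
by rewrite powR_mulrn// normrX.
Qed.

Section Spectrum.
Context {R : realType} (mu : probability (measurableTypeR R) R) (Gamma : set R).
Implicit Types (s t a b : R) (f g h : R -> R[i]).

(** Lists of pairs may repeat frequencies, so that sums are concatenations. *)
Definition char_span : set (R -> R[i]) := [set h | exists l : seq (R * R[i]),
  (forall p, p \in l -> Gamma p.1) /\
  h = fun x => \sum_(p <- l) p.2 * exp_char p.1 x].

Lemma cmeasurable_exp_char t : cmeasurable (exp_char t : measurableTypeR R -> R[i]).
Proof. by split; [exact: measurable_cosM|exact: measurable_sinM]. Qed.

Lemma char_span_cmeasurable h :
  char_span h -> cmeasurable (h : measurableTypeR R -> R[i]).
Proof.
move=> [l [_ ->]]; elim: l => [|p l IHl].
  by under eq_fun do rewrite big_nil; apply: (@cmeasurable_real _ _ _ (cst 0)).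
under eq_fun do rewrite big_cons.
by apply: cmeasurableD => //; apply: cmeasurableZ; exact: cmeasurable_exp_char.
Qed.

Lemma char_spanD f g : char_span f -> char_span g -> char_span (fun x => f x + g x).
Proof.
move=> [l [lG ->]] [m [mG ->]]; exists (l ++ m); split.
  by move=> p; rewrite mem_cat => /orP[/lG|/mG].
by apply/funext => x; rewrite big_cat.
Qed.

Lemma char_spanZ (c : R[i]) f : char_span f -> char_span (fun x => c * f x).
Proof.
move=> [l [lG ->]]; exists [seq (p.1, c * p.2) | p <- l]; split.
  by move=> _ /mapP[p /lG pG ->].
apply/funext => x; rewrite big_map mulr_sumr.
by apply: eq_bigr => p _; rewrite mulrA.
Qed.

Lemma char_span_coef h : char_span h -> exists (r : seq R) (c : R -> R[i]),
  (forall a, a \in r -> Gamma a) /\ h = fun x => \sum_(a <- r) c a * exp_char a x.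
Proof.
move=> [l [lG ->]]; exists (undup [seq p.1 | p <- l]).
exists (fun a => \sum_(p <- l | p.1 == a) p.2); split.
  by move=> a; rewrite mem_undup => /mapP[p /lG pG ->].
apply/funext => x; under [RHS]eq_bigr do rewrite mulr_suml.
rewrite (exchange_big_dep predT)//= big_seq [RHS]big_seq; apply: eq_bigr => p pl.
rewrite (eq_bigl (pred1 p.1)) => [|a]; last by rewrite /= eq_sym.
rewrite -big_filter filter_pred1_uniq ?undup_uniq ?big_seq1//.
by rewrite mem_undup map_f.
Qed.

Hypothesis orth : forall a b, Gamma a -> Gamma b -> a != b ->
  fourier mu (a - b) = 0.
Hypothesis total : forall t (e : R), 0 < e -> exists2 r : seq R, uniq r &
  (forall a, a \in r -> Gamma a) /\
  1 - e < \sum_(a <- r) fourier_sqr mu (t - a).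

Lemma exp_char_closure t : L2closure mu char_span (exp_char t).
Proof.
split=> [|e e0]; first exact: cmeasurable_exp_char.
have [r ur [rG tr]] := total t e0.
exists (fun x => \sum_(a <- r) fourier mu (t - a) * exp_char a x).
  exists [seq (a, fourier mu (t - a)) | a <- r]; split.
    by move=> _ /mapP[a /rG aG ->].
  by apply/funext => x; rewrite big_map.
rewrite L2dist2_exp_char_projection//; first by rewrite lte_fin; lra.
by move=> a b /rG aG /rG bG; exact: orth.
Qed.

Lemma L2C_exp_char t : L2C mu (exp_char t).
Proof.
split.
  by apply: (bounded_Lfun2 mu (measurable_cosM _)) => x; exact: cos_max.
by apply: (bounded_Lfun2 mu (measurable_sinM _)) => x; exact: sin_max.
Qed.

Lemma L2C_closure f : L2C mu f -> L2closure mu char_span f.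
Proof.
move=> [fRe fIm].
apply: (@trigonometric_density R mu (L2closure mu char_span)).
- exact: exp_char_closure.
- by move=> g h; apply: L2closureD; [exact: char_span_cmeasurable|exact: char_spanD].
- by move=> c g; apply: L2closureZ; [exact: char_span_cmeasurable|exact: char_spanZ].
- by move=> u_ u v; apply: L2closure_dominated; exact: char_span_cmeasurable.
- split.
  + by have /sub_Lfun_mfun/set_mem := fRe.
  + by have /sub_Lfun_mfun/set_mem := fIm.
- exact: (Lfun2_integrable_sqr fRe).
- exact: (Lfun2_integrable_sqr fIm).
Qed.

Lemma L2C_norm_sqrt f :
  L2C_norm mu f = ((\int[mu]_x (sqmod (f x))%:E) `^ 2^-1)%E.
Proof.
rewrite /L2C_norm unlock; congr (_ `^ _)%E; apply: eq_integral => x _ /=.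
rewrite normc_sqmod ger0_norm ?sqrtr_ge0//.
by rewrite powR_mulrn ?sqrtr_ge0// sqr_sqrtr ?sqmod_ge0.
Qed.

(** The transform does not vanish near 0, so that orthogonal frequencies are
    uniformly separated. *)
Lemma spectrum_discrete : discrete_subset Gamma.
Proof.
move=> a Ga; split; first exact: mem_set.
have h0 : (0 : R) < 2^-1 by rewrite invr_gt0.
have [r r0 rP] := fourier_sqr_near0 mu h0.
exists (ball a r); first exact: nbhsx_ballx.
apply/seteqP; split => [b [/= abr Gb]|_ -> ]; last by split=> //; exact: ballxx.
apply/eqP/negPn/negP => ba; have := rP (b - a).
rewrite -sqmod_fourier (orth Gb Ga ba) /sqmod/= expr0n/= addr0.
have -> : `|b - a| <= r by move: abr; rewrite /ball/= distrC => /ltW.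
by move=> /(_ isT); lra.
Qed.

(** Parseval's identity for all characters puts them into the closed span. *)
Lemma spectrum_criterion : is_spectrum mu Gamma.
Proof.
split; first exact: spectrum_discrete.
split.
- by move=> a _; exact: L2C_exp_char.
- move=> a b Ga Gb; rewrite L2C_inner_exp_char.
  by case: eqVneq => [->|ab]; [rewrite subrr fourier0|exact: orth].
- move=> f /L2C_closure[mf fP] eps eps0.
  have [h /[dup] Vh /char_span_coef[r [c [rG hE]]] fh] := fP _ (exprn_gt0 2 eps0).
  exists r, c; split=> //.
  rewrite L2C_norm_sqrt; move: fh; rewrite hE /L2dist2.
  have : (0 <= \int[mu]_x (sqmod (f x - \sum_(a <- r) c a * exp_char a x))%:E)%E.
    by apply: integral_ge0 => x _; rewrite lee_fin sqmod_ge0.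
  case: (integral _ _ _) => [y|//|//]; rewrite lee_fin lte_fin => y0 yeps.
  rewrite poweR_EFin powR12_sqrt// lte_fin -(gtr0_norm eps0) -sqrtr_sqr.
  by rewrite ltr_sqrt ?exprn_gt0.
Qed.

End Spectrum.

(** * Counting discrete sets of reals *)

Section Cardinality.
Context {R : realType}.
Implicit Types (b : nat -> bool) (n m : nat) (Lambda : set R).

Definition ternary_sum b n : R := \sum_(k < n) (b k)%:R * 3^-1 ^+ k.

Lemma ternary_sumS b n : ternary_sum b n.+1 = ternary_sum b n + (b n)%:R * 3^-1 ^+ n.
Proof. by rewrite /ternary_sum big_ord_recr. Qed.

Lemma third_expr_gt0 n : (0 : R) < 3^-1 ^+ n.
Proof. by rewrite exprn_gt0// invr_gt0. Qed.

Lemma ternary_sum_homo b : nondecreasing_seq (ternary_sum b).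
Proof.
by apply/nondecreasing_seqP => n; rewrite ternary_sumS lerDl mulr_ge0.
Qed.

Lemma ternary_sum_tail b n m :
  ternary_sum b (n + m) <= ternary_sum b n + 3 / 2 * (3^-1 ^+ n - 3^-1 ^+ (n + m)).
Proof.
elim: m => [|m IHm]; first by rewrite addn0 subrr mulr0 addr0.
rewrite addnS ternary_sumS exprS; have := third_expr_gt0 (n + m).
have : (b (n + m))%:R <= (1 : R) by case: (b _).
move: (b _)%:R (3^-1 ^+ (n + m)) IHm => c u IHm c1 u0.
have := ler_wpM2r (ltW u0) c1; lra.
Qed.

(** In base 3 the digits 0 and 1 determine the number. *)
Definition real_of_bits b : R := sup (range (ternary_sum b)).

Lemma ternary_sum_le b n m : ternary_sum b m <= ternary_sum b n + 3 / 2 * 3^-1 ^+ n.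
Proof.
have n0 := third_expr_gt0 n.
have [/subnKC <-|/ltnW mn] := leqP n m.
  apply: le_trans (ternary_sum_tail _ _ _) _.
  by have := third_expr_gt0 (n + (m - n)); lra.
by apply: le_trans (ternary_sum_homo b mn) _; lra.
Qed.

Lemma ternary_sum_le_real b n : ternary_sum b n <= real_of_bits b.
Proof.
apply: ub_le_sup; last by exists n.
exists (ternary_sum b 0 + 3 / 2 * 3^-1 ^+ 0) => _ [m _ <-].
exact: ternary_sum_le.
Qed.

Lemma real_le_ternary_sum b n : real_of_bits b <= ternary_sum b n + 3 / 2 * 3^-1 ^+ n.
Proof.
apply: ge_sup; first by exists (ternary_sum b 0), 0%N.
by move=> _ [m _ <-]; exact: ternary_sum_le.
Qed.

Lemma real_of_bits_inj : injective real_of_bits.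
Proof.
suff lt b b' n : (forall m, (m < n)%N -> b m = b' m) -> b n -> ~~ b' n ->
    real_of_bits b' < real_of_bits b.
  move=> b b' bb'; apply/funext => k; apply/eqP; apply: contraT => bk.
  have ex : exists n, b n != b' n by exists k.
  case: (ex_minnP ex) => n bn min.
  have eqm m : (m < n)%N -> b m = b' m.
    by move=> mn; apply/eqP; apply: contraTT mn => /min; rewrite -leqNgt.
  case bE: (b n); case b'E: (b' n); rewrite ?bE ?b'E// in bn.
    by have := lt b b' n eqm bE (negbT b'E); rewrite bb' ltxx.
  have := lt b' b n (fun m mn => esym (eqm m mn)) b'E (negbT bE).
  by rewrite bb' ltxx.
move=> eqm bn b'n.
have := real_le_ternary_sum b' n.+1; have := ternary_sum_le_real b n.+1.
rewrite !ternary_sumS bn (negbTE b'n) /= exprS.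
have -> : ternary_sum b' n = ternary_sum b n.
  by apply: eq_bigr => k _; rewrite eqm.
have := third_expr_gt0 n; lra.
Qed.

Lemma not_countable_real : ~ countable [set: R].
Proof.
move=> /countable_lebesgue_measure0; rewrite -set_itvNyy lebesgue_measure_itv/=.
by [].
Qed.

Definition rational_code Lambda n : bool :=
  if @unpickle (rat * rat)%type n is Some q
  then `[< exists2 x, Lambda x & ratr q.1 < x < ratr q.2 >] else false.

Lemma rational_codeP Lambda (p q : rat) :
  rational_code Lambda (pickle (p, q)) <->
  exists2 x, Lambda x & ratr p < x < ratr q.
Proof. by rewrite /rational_code pickleK; split => [/asboolP|?]//; exact/asboolP. Qed.

Lemma rational_interval (x r : R) : 0 < r ->
  exists p q : rat, [/\ x - r < ratr p, ratr p < x, x < ratr q & ratr q < x + r].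
Proof.
move=> r0; have [p] := rat_in_itvoo (ltac:(lra) : x - r < x).
have [q] := rat_in_itvoo (ltac:(lra) : x < x + r).
by rewrite !in_itv/= => /andP[? ?] /andP[? ?]; exists p, q.
Qed.

(** A point [x] of [L] is isolated by a rational interval. That interval meets [L'];
    a point of [L'] in it other than [x] would be in a smaller rational interval
    that misses [L]. *)
Lemma rational_code_sub (L L' : set R) : discrete_subset L ->
  rational_code L = rational_code L' -> L `<=` L'.
Proof.
move=> dL eqc x Lx.
have codeE p q := rational_codeP L' p q; rewrite -eqc in codeE.
have [_ [W /nbhs_ballP[r /= r0 rW] WL]] := dL x Lx.
have only y : L y -> `|x - y| < r -> y = x.
  move=> Ly xyr; have : (W `&` L) y by split=> //; exact: rW.
  by rewrite WL.
have [p [q [xp px xq qx]]] := rational_interval x r0.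
have [|y L'y /andP[py yq]] := (codeE p q).1.
  by apply/rational_codeP; exists x => //; rewrite px.
have [<-//|yx] := eqVneq y x.
have m0 : 0 < Num.min `|y - x| (Num.min (y - ratr p) (ratr q - y)).
  by rewrite !lt_min normr_gt0 subr_eq0 yx !subr_gt0 py.
have [p' [q' [yp' p'y yq' q'y]]] := rational_interval y m0.
have [|z Lz /andP[pz zq]] := (rational_codeP L p' q').1.
  by apply/(codeE p' q'); exists y => //; rewrite p'y.
have zy : `|z - y| < Num.min `|y - x| (Num.min (y - ratr p) (ratr q - y)).
  by rewrite ltr_distl (lt_trans yp' pz) (lt_trans zq q'y).
move: zy; rewrite !lt_min ltr_distl => /and3P[zyx zyp zyq].
have zx : z = x.
  apply: only => //; rewrite ltr_distlC; apply/andP.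
  by move: zyp zyq; rewrite !ltr_norml => /andP[? ?] /andP[? ?]; split; lra.
by move: zyx; rewrite zx -ltr_distl distrC ltxx.
Qed.

Lemma discrete_subset_card_le (S : set (set R)) :
  (forall L, S L -> discrete_subset L) -> S #<= [set: R].
Proof.
move=> dS; pose f L := real_of_bits (rational_code L).
have finj : {in S &, injective f}.
  move=> L L' /set_mem/dS dL /set_mem/dS dL' /real_of_bits_inj LL'.
  by apply/seteqP; split; exact: rational_code_sub.
have := inj_card_eq finj; rewrite card_eq_le => /andP[_ Sf].
by apply: card_le_trans Sf _; exact: subset_card_le.
Qed.

End Cardinality.

(** * Spectra of the Cantor measure *)

Section TowerSpectrum.
Context {R : realType} (mu4 : probability (measurableTypeR R) R).
Hypothesis hmu4 : is_mu4 mu4.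
Variables (N : nat -> nat) (A : nat -> seq R).
Hypothesis towerA : spectral_tower N A.
Hypothesis A0 : A 0 = [:: 0].

Definition tower_union : set R := [set a | exists i, a \in A i].

Lemma tower_homo i j : (i <= j)%N -> {subset A i <= A j}.
Proof.
move=> /subnKC <-; elim: (j - i)%N => [|m IHm]; first by rewrite addn0.
move=> a /IHm aA; rewrite addnS; have [_ _ _ [C -> _]] := towerA (i + m).
by rewrite mem_cat aA.
Qed.

(** Two elements are in a common level, and zeros of a level are zeros of the
    transform. *)
Lemma tower_union_orthogonal k a b : tower_union a -> tower_union b -> a != b ->
  fourier mu4 ((2 * k + 1)%:~R * (a - b)) = 0.
Proof.
move=> [i ai] [j bj] ab.
have {}ai := tower_homo (leq_maxl i j) ai.
have {}bj := tower_homo (leq_maxr i j) bj.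
have [sA _ _ _] := towerA (maxn i j).
have : fourier_sqr mu4 ((2 * k + 1)%:~R * (a - b)) = 0.
  rewrite (refinableE (fourier_sqr_mu4 hmu4) (N (maxn i j))).
  by rewrite (riesz_product_orthogonal k sA ai bj ab) mul0r.
rewrite /fourier_sqr => /eqP; rewrite paddr_eq0 ?sqr_ge0// !sqrf_eq0.
by case: (fourier _ _) => u v /= /andP[/eqP -> /eqP ->].
Qed.

Definition translate (s : R) (L : set R) : set R := [set a + s | a in L].

(** Translating the set translates [t] in Parseval's identity, which holds for
    all [t]. *)
Lemma tower_spectrum k s :
  is_spectrum mu4 (dilate (2 * k + 1)%:~R (translate s tower_union)).
Proof.
apply: spectrum_criterion.
- move=> _ _ [_ [a Ta <-] <-] [_ [b Tb <-] <-].
  rewrite -mulrBr opprD addrACA subrr addr0 => ab.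
  by apply: tower_union_orthogonal => //; apply: contraNneq ab => ->.
- move=> t e e0; have e20 : 0 < e / 2 by rewrite divr_gt0.
  (* The sum is over [t - p (a + s)], and [- p = 2 (- k - 1) + 1]. *)
  have [i Ai] := spectral_tower_sum_cvg1 (fourier_sqr_mu4 hmu4)
    (fourier_sqr_ge0 mu4) (fourier_sqr_le1 mu4) (@fourier_sqr_near0 _ mu4)
    towerA (- k - 1) (t - (2 * k + 1)%:~R * s) e20.
  have [sA _ _ _] := towerA i.
  have p0 : (2 * k + 1)%:~R != 0 :> R.
    by rewrite intr_eq0; lia.
  exists [seq (2 * k + 1)%:~R * (a + s) | a <- A i].
    rewrite map_inj_uniq ?(spectral_level_uniq sA)// => a b /(mulfI p0).
    exact: addIr.
  split.
    move=> _ /mapP[a aA ->]; exists (a + s) => //.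
    by exists a => //; exists i.
  rewrite big_map; apply: lt_le_trans (_ : 1 - e / 2 <= _); first by lra.
  apply: le_trans Ai _; rewrite le_eqVlt; apply/orP; left; apply/eqP.
  apply: eq_bigr => a _; congr (fourier_sqr _ _).
  by rewrite !(intrD, intrM, intrN, rmorphB)/=; ring.
Qed.

Lemma tower_union_ge0 a : tower_union a -> 0 <= a.
Proof. by move=> [j]; have [_ A01 _ _] := towerA j; move=> /A01/andP[]. Qed.

(** The least element of the translate by [s] is [s]. *)
Lemma translate_tower_inj : injective (translate^~ tower_union).
Proof.
have T0 : tower_union 0 by exists 0; rewrite A0 inE.
have le s s' : translate s tower_union = translate s' tower_union -> s' <= s.
  move=> E; have : translate s' tower_union s.
    by rewrite -E; exists 0; rewrite ?add0r.
  by move=> [a /tower_union_ge0 a0 <-]; rewrite lerDr.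
by move=> s s' E; apply/eqP; rewrite eq_le !le.
Qed.

End TowerSpectrum.

Theorem theorem1p2 (R : realType) (mu4 : probability (measurableTypeR R) R)
    (hmu4 : is_mu4 mu4) :
  let S := \bigcap_(p in odd_integers)
    [set Lambda : set R |
      is_spectrum mu4 Lambda /\ is_spectrum mu4 (dilate p%:~R Lambda)] in
  S #= [set: R] /\ ~ countable S.
Proof.
move=> S.
have [N [A [towerA A0]]] := @exists_spectral_tower R.
have SR : S #= [set: R].
  rewrite card_eq_le; apply/andP; split.
    apply: discrete_subset_card_le => L SL.
    have odd1 : odd_integers 1 by exists 0; rewrite ?mulr0 ?add0r.
    by have [[]] := SL 1 odd1.
  have injt : {in [set: R] &, injective (fun s => translate s (tower_union A))}.
    by move=> s s' _ _; exact: translate_tower_inj.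
  have := inj_card_eq injt; rewrite card_eq_le => /andP[_ Rt].
  apply: card_le_trans Rt _; apply: subset_card_le => _ [s _ <-] _ [k _ <-].
  split; last exact: tower_spectrum.
  have := tower_spectrum hmu4 towerA 0 s; rewrite mulr0 add0r.
  congr is_spectrum; rewrite /dilate; under eq_fun do rewrite mul1r.
  by rewrite image_id.
split=> // cS; apply: (@not_countable_real R).
by rewrite -(eq_countable SR).
Qed.
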